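(* Let $X\subseteq K^{2\times2\times2}$ be the hypersurface defined by Cayley's hyperdeterminant, equipped with the natural action of $\mathbb{G}_{\mathrm m}^2\times\mathbb{G}_{\mathrm m}^2\times\mathbb{G}_{\mathrm m}^2$. Let $X^{\mathrm{an}}\to Z$, $w\mapsto\mu(0,w)$, be the retraction defined relative to this torus action (see context). Then the surjection $\mathrm{trop}: Z^0\to\mathrm{Trop}(X^0)$ has a continuous, $\mathbb{R}^2\times\mathbb{R}^2\times\mathbb{R}^2$-equivariant section.
   Context: $\mathbb{R}_\infty := \mathbb{R}\cup\{\infty\}$ carries the topology of a half-open interval. $K$ is a field with a non-Archimedean valuation $v: K \to \mathbb{R}_\infty$, assumed surjective. For an affine variety $X$ over $K$, $X^{\mathrm{an}}$ is the set of all ring valuations $w: K[X] \to \mathbb{R}_\infty$ extending $v$, with the topology of pointwise convergence; $\mathrm{trop}$ sends $w$ to the vector of values of $w$ on the coordinates, and the tropicalisation is the image of $\mathrm{trop}$. On $\mathbb{A}^8=K^{2\times2\times2}$ use coordinates $x_{ijk}$, $i,j,k\in\{0,1\}$. Cayley's hyperdeterminant is $$\begin{aligned}\Delta={}&x_{000}^2x_{111}^2+x_{001}^2x_{110}^2+x_{010}^2x_{101}^2+x_{100}^2x_{011}^2\\&-2x_{000}x_{001}x_{110}x_{111}-2x_{000}x_{010}x_{101}x_{111}-2x_{000}x_{011}x_{100}x_{111}\\&-2x_{001}x_{010}x_{101}x_{110}-2x_{001}x_{011}x_{110}x_{100}-2x_{010}x_{011}x_{101}x_{100}\\&+4x_{000}x_{011}x_{101}x_{110}+4x_{001}x_{010}x_{100}x_{111}.\end{aligned}$$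 The torus $\mathbb{G}_{\mathrm m}^2\times\mathbb{G}_{\mathrm m}^2\times\mathbb{G}_{\mathrm m}^2$ with coordinates $t_i,u_j,v_k$ acts by $x_{ijk}\mapsto t_iu_jv_kx_{ijk}$; $X$ is stable. Every $f\in K[X]$ decomposes uniquely as a finite sum $f=\sum_{\beta\in\mathbb{Z}^6}f_\beta$ of torus weight vectors ($f_\beta$ being multiplied by the character with exponent $\beta$ under the substitution $x\mapsto (t,u,v)\cdot x$). Define $\mu:\mathbb{R}^6\times X^{\mathrm{an}}\to X^{\mathrm{an}}$ by $\mu(\tau,w)(f):=\min_\beta(w(f_\beta)+\beta\cdot\tau)$, and let $Z$ be the image of $\mu$; $\mu$ restricts to a continuous action of $\mathbb{R}^6=\mathbb{R}^2\times\mathbb{R}^2\times\mathbb{R}^2$ on $Z$. $X^0\subseteq X$ is the open subset where no coordinate vanishes; $\mathrm{Trop}(X^0)=\mathrm{Trop}(X)\cap\mathbb{R}^8$; $Z^0:=\{w\in Z: w(x_{ijk})\ne\infty\text{ for all }i,j,k\}$. The action of $\mathbb{R}^6$ on $\mathrm{Trop}(X^0)$ is $((\rho,\delta,\nu),\xi)\mapsto(\rho_i+\delta_j+\nu_k+\xi_{ijk})_{ijk}$. *)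

(* Defs.v *)
From HB Require Import structures.
From mathcomp Require Import all_boot all_order all_algebra.
From mathcomp Require mpoly.
From mathcomp Require Import boolp.

Set Implicit Arguments.
Unset Strict Implicit.
Unset Printing Implicit Defensive.

Import Order.TTheory GRing.Theory Num.Theory.

Notation cube := ('I_2 * 'I_2 * 'I_2)%type.
Notation triple T := ('rV[T]_2 * 'rV[T]_2 * 'rV[T]_2)%type.

Module HyperdetAlgebra.
Import mpoly.
Local Open Scope ring_scope.
Local Open Scope quotient_scope.

Section HyperdetAlgebra.
Variable K : fieldType.
Local Notation Kx := {mpoly K[#|{: cube}|]}.

Definition xpoly (a : cube) : Kx := 'X_(enum_rank a).

Definition hyperdet : Kx :=
  let x i j k := xpoly (i, j, k) in
  x 0 0 0 ^+ 2 * x 1 1 1 ^+ 2 + x 0 0 1 ^+ 2 * x 1 1 0 ^+ 2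
  + x 0 1 0 ^+ 2 * x 1 0 1 ^+ 2 + x 1 0 0 ^+ 2 * x 0 1 1 ^+ 2
  - 2 * x 0 0 0 * x 0 0 1 * x 1 1 0 * x 1 1 1
  - 2 * x 0 0 0 * x 0 1 0 * x 1 0 1 * x 1 1 1
  - 2 * x 0 0 0 * x 0 1 1 * x 1 0 0 * x 1 1 1
  - 2 * x 0 0 1 * x 0 1 0 * x 1 0 1 * x 1 1 0
  - 2 * x 0 0 1 * x 0 1 1 * x 1 1 0 * x 1 0 0
  - 2 * x 0 1 0 * x 0 1 1 * x 1 0 1 * x 1 0 0
  + 4 * x 0 0 0 * x 0 1 1 * x 1 0 1 * x 1 1 0
  + 4 * x 0 0 1 * x 0 1 0 * x 1 0 0 * x 1 1 1.

(* The ideal generated by Delta.  In characteristic 2 it is not radical, but a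
   ring valuation takes the value +oo on every nilpotent, so passing to the
   reduced coordinate ring changes nothing below. *)
Definition hyperdet_ideal : Kx -> bool := fun f => `[< exists g, f = g * hyperdet >].

Lemma hyperdet_ideal_closed : idealr_closed hyperdet_ideal.
Proof.
split.
- by apply/asboolP; exists 0; rewrite mul0r.
- apply/negP => /asboolP[g /(congr1 (meval (fun=> 0)))] /eqP.
  rewrite meval1 mevalM /hyperdet /xpoly !expr2 !(mevalD, mevalN, mevalM).
  by rewrite !mevalXU !(mulr0, oppr0, addr0) oner_eq0.
- move=> a x y /asboolP[g ->] /asboolP[h ->].
  by apply/asboolP; exists (a * g + h); rewrite mulrDl mulrA.
Qed.

HB.instance Definition _ :=
  isIdealr.Build Kx (@hyperdet_ideal) hyperdet_ideal_closed.

Definition coord_ring : Type := {ideal_quot (hyperdet_ideal : idealr Kx)}.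
HB.instance Definition _ := GRing.ComNzRing.copy coord_ring
  {ideal_quot (hyperdet_ideal : idealr Kx)}.
HB.instance Definition _ := NzRingQuotient.copy coord_ring
  {ideal_quot (hyperdet_ideal : idealr Kx)}.
Local Notation KX := coord_ring.

Definition coord (a : cube) : KX := \pi_KX (xpoly a).
Definition scalar (c : K) : KX := \pi_KX (c%:MP).

(* Points (t, u, v) of the torus are triples of row vectors with nonzero
   entries; weights are triples of integer row vectors. *)
Definition torus_point (s : triple K) : Prop :=
  forall i, [&& s.1.1 0 i != 0, s.1.2 0 i != 0 & s.2 0 i != 0].

Definition character (b : triple int) (s : triple K) : K :=
  \prod_i (s.1.1 0 i ^ b.1.1 0 i * s.1.2 0 i ^ b.1.2 0 i * s.2 0 i ^ b.2 0 i).

Definition torus_subst_poly (s : triple K) (p : Kx) : Kx :=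
  let y (a : cube) := (s.1.1 0 a.1.1 * s.1.2 0 a.1.2 * s.2 0 a.2) *: xpoly a in
  p \mPo [tuple y (enum_val l) | l < #|{: cube}|].

Definition torus_subst (s : triple K) (f : KX) : KX :=
  \pi_KX (torus_subst_poly s (repr f)).

Definition weight_vector (b : triple int) (f : KX) : Prop :=
  forall s, torus_point s -> torus_subst s f = scalar (character b s) * f.

Definition weight_decomposition (f : KX) (c : triple int -> KX) : Prop :=
  (forall b, weight_vector b (c b)) /\
  exists B : seq (triple int),
    [/\ uniq B, forall b, b \notin B -> c b = 0 & f = \sum_(b <- B) c b].

Definition monomial_weight (m : 'X_{1..#|{: cube}|}) : triple int :=
  let e i j k := Posz (m (enum_rank ((i, j, k) : cube))) in
  (\row_i \sum_j \sum_k e i j k,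
   \row_j \sum_i \sum_k e i j k,
   \row_k \sum_i \sum_j e i j k).

Definition weight_component_poly (b : triple int) (p : Kx) : Kx :=
  \sum_(m <- msupp p | monomial_weight m == b) p@_m *: 'X_[m].

(* f_beta: weight_componentP and weight_component_uniq below show that these
   classes are the unique decomposition of f into weight vectors. *)
Definition weight_component (b : triple int) (f : KX) : KX :=
  \pi_KX (weight_component_poly b (repr f)).

Local Notation mw := monomial_weight.
Local Notation wcp := weight_component_poly.
Local Notation tsp := torus_subst_poly.

Lemma monomial_weightD m1 m2 : mw (m1 + m2)%MM = mw m1 + mw m2.
Proof.
rewrite /mw; congr (_, _, _); apply/rowP => i; rewrite !mxE -big_split /=;
  apply: eq_bigr => j _; rewrite -big_split /=; apply: eq_bigr => k _;
  by rewrite mnmDE PoszD.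
Qed.

Lemma mcoeff_wcp b p m : (wcp b p)@_m = if mw m == b then p@_m else 0.
Proof.
rewrite /wcp raddf_sum /= big_mkcond /=.
transitivity (\sum_(i <- msupp p) if i == m then
   (if mw m == b then p@_m else 0) else 0).
  apply: eq_bigr => i _; have [<-|ne] := eqVneq i m.
    by case: ifP => _ //; rewrite mcoeffZ mcoeffX eqxx mulr1.
  by case: ifP => _ //; rewrite mcoeffZ mcoeffX (negbTE ne) mulr0.
rewrite -big_mkcond /= -big_filter.
have [mp|mp] := boolP (m \in msupp p).
  by rewrite filter_pred1_uniq ?msupp_uniq // big_seq1.
rewrite (memN_msupp_eq0 mp) if_same big1 //.
Qed.

Lemma wcp_is_linear b : linear (wcp b).
Proof.
move=> c p q; apply/mpolyP => m; rewrite !(mcoeff_wcp, mcoeffD, mcoeffZ).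
by case: ifP => // _; rewrite mulr0 addr0.
Qed.
HB.instance Definition _ b :=
  GRing.isLinear.Build K Kx Kx _ (wcp b) (wcp_is_linear b).

Lemma wcpX b m : wcp b 'X_[m] = if mw m == b then 'X_[m] else 0.
Proof.
apply/mpolyP => k; rewrite mcoeff_wcp mcoeffX.
have [<-|ne] := eqVneq m k; first by case: ifP => _; rewrite ?mcoeffX ?eqxx ?mcoeff0.
by case: ifP => _; case: ifP => _; rewrite ?mcoeffX ?(negbTE ne) ?mcoeff0.
Qed.

Definition isobaric (b : triple int) (p : Kx) := wcp b p = p.

Lemma isobaricX m : isobaric (mw m) 'X_[m].
Proof. by rewrite /isobaric wcpX eqxx. Qed.

Lemma wcpM b d g p : isobaric d p -> wcp b (g * p) = wcp (b - d) g * p.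
Proof.
move=> hp; have pE : p = \sum_(m <- msupp p | mw m == d) p@_m *: 'X_[m].
  exact/esym.
rewrite {1 2}pE !mulr_sumr linear_sum /=; apply: eq_bigr => m /eqP md.
rewrite {1}[g]mpolyE mulr_suml linear_sum /= [in RHS]/wcp mulr_suml [RHS]big_mkcond.
apply: eq_bigr => m' _; rewrite -scalerAr -scalerAl scalerA -mpolyXD linearZ /=.
rewrite wcpX monomial_weightD md.
rewrite [in LHS]eq_sym -subr_eq [in LHS]eq_sym.
by case: ifP => _; rewrite ?scaler0.
Qed.

Lemma isobaricM b d g p : isobaric b g -> isobaric d p -> isobaric (b + d) (g * p).
Proof. by move=> hg hp; rewrite /isobaric (wcpM _ _ hp) addrK hg. Qed.

Lemma isobaricD b p q : isobaric b p -> isobaric b q -> isobaric b (p + q).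
Proof. by move=> hp hq; rewrite /isobaric linearD /= hp hq. Qed.

Lemma isobaricB b p q : isobaric b p -> isobaric b q -> isobaric b (p - q).
Proof. by move=> hp hq; rewrite /isobaric linearB /= hp hq. Qed.

Lemma isobaric_natr k : isobaric 0 k%:R.
Proof.
have -> : 0 = mw 0%MM.
  by apply: (addrI (mw 0%MM)); rewrite addr0 -monomial_weightD addm0.
rewrite -(mpolyX0 _ K) /isobaric linearMn /=; congr (_ *+ _).
exact: isobaricX.
Qed.

Definition xweight (a : cube) : triple int :=
  (delta_mx 0 a.1.1, delta_mx 0 a.1.2, delta_mx 0 a.2).

Lemma mw_xpoly (a : cube) : mw U_(enum_rank a) = xweight a.
Proof.
have U (p q : cube) : U_(enum_rank p)%MM (enum_rank q) = (p == q).
  by rewrite mnm1E (inj_eq enum_rank_inj).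
case: a => [[a b] c]; congr (_, _, _); apply/rowP => i; rewrite !mxE /=.
- rewrite (bigD1 b) //= (bigD1 c) //= U [X in _ + X + _]big1 ?[X in _ + X]big1.
  + by rewrite !addr0 !xpair_eqE !eqxx !andbT eq_sym; case: eqP.
  + move=> j jb; rewrite big1 // => k _.
    by rewrite U; case: eqP => // -[*]; case/eqP: jb.
  + by move=> k kc; rewrite U; case: eqP => // -[*]; case/eqP: kc.
- rewrite (bigD1 a) //= (bigD1 c) //= U [X in _ + X + _]big1 ?[X in _ + X]big1.
  + by rewrite !addr0 !xpair_eqE !eqxx !andbT eq_sym; case: eqP.
  + move=> j jb; rewrite big1 // => k _.
    by rewrite U; case: eqP => // -[*]; case/eqP: jb.
  + by move=> k kc; rewrite U; case: eqP => // -[*]; case/eqP: kc.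
- rewrite (bigD1 a) //= (bigD1 b) //= U [X in _ + X + _]big1 ?[X in _ + X]big1.
  + by rewrite !addr0 !xpair_eqE !eqxx eq_sym; case: eqP.
  + move=> j jb; rewrite big1 // => k _.
    by rewrite U; case: eqP => // -[*]; case/eqP: jb.
  + by move=> k kc; rewrite U; case: eqP => // -[*]; case/eqP: kc.
Qed.

Lemma isobaric_xpoly a : isobaric (xweight a) (xpoly a).
Proof. by rewrite -mw_xpoly; exact: isobaricX. Qed.

Definition hyperdet_weight : triple int :=
  (const_mx 2, const_mx 2, const_mx 2).

Lemma isobaric_eq b b' p : isobaric b p -> b = b' -> isobaric b' p.
Proof. by move=> ? <-. Qed.

Lemma isobaric_hyperdet : isobaric hyperdet_weight hyperdet.
Proof.
rewrite /hyperdet !expr2.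
repeat (apply: isobaricB || apply: isobaricD).
all: (apply: isobaric_eq; [repeat (apply: isobaricM); exact: isobaric_xpoly || exact: isobaric_natr|]).
all: congr (_, _, _); apply/rowP => i; rewrite !mxE; case: i => [[|[|//]] ?].
all: by [].
Qed.

Lemma wcp_ideal b p : p \in hyperdet_ideal -> wcp b p \in hyperdet_ideal.
Proof.
case/asboolP => g ->; apply/asboolP; exists (wcp (b - hyperdet_weight) g).
exact: wcpM isobaric_hyperdet.
Qed.

Lemma eq_pi (p q : Kx) : (\pi_KX p = \pi_KX q) <-> (p - q \in hyperdet_ideal).
Proof. by split=> [/eqP|h]; [|apply/eqP]; rewrite -Quotient.idealrBE. Qed.

Lemma weight_component_pi b p : weight_component b (\pi_KX p) = \pi_KX (wcp b p).
Proof.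
apply/eq_pi; rewrite -linearB; apply: wcp_ideal; apply/eq_pi.
by rewrite reprK.
Qed.

Lemma characterD b d s : torus_point s ->
  character (b + d) s = character b s * character d s.
Proof.
move=> sP; rewrite /character -big_split; apply: eq_bigr => i _ /=.
by have /and3P[? ? ?] := sP i; rewrite !mxE !expfzDr // [X in X * _]mulrACA [LHS]mulrACA.
Qed.

Lemma character_xweight a s :
  character (xweight a) s = s.1.1 0 a.1.1 * s.1.2 0 a.1.2 * s.2 0 a.2.
Proof.
have E (r : 'rV[K]_2) k : \prod_i r 0 i ^ (delta_mx 0 k : 'rV[int]_2) 0 i = r 0 k.
  rewrite (bigD1 k) //= mxE !eqxx expr1z big1 ?mulr1 // => i ik.
  by rewrite mxE (negbTE ik) andbF expr0z.
by rewrite /character !big_split /= !E.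
Qed.

Lemma tspX s m : torus_point s -> tsp s 'X_[m] = character (mw m) s *: 'X_[m].
Proof.
move=> sP; rewrite [m]multinomUE_id.
have P0 : tsp s 'X_[0%MM] = character (mw 0%MM) s *: 'X_[0%MM].
  have -> : mw 0%MM = 0.
    by apply: (addrI (mw 0%MM)); rewrite addr0 -monomial_weightD addm0.
  rewrite mpolyX0 /tsp comp_mpoly1 /character big1 ?scale1r // => i _.
  by rewrite !mxE !expr0z !mul1r.
have PD m1 m2 : tsp s 'X_[m1] = character (mw m1) s *: 'X_[m1] ->
    tsp s 'X_[m2] = character (mw m2) s *: 'X_[m2] ->
    tsp s 'X_[m1 + m2] = character (mw (m1 + m2)%MM) s *: 'X_[m1 + m2].
  move=> h1 h2; rewrite monomial_weightD characterD // mpolyXD /tsp rmorphM /=.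
  by rewrite -!/(tsp _ _) h1 h2 -scalerAl -scalerAr scalerA.
apply: (big_ind (fun m => tsp s 'X_[m] = character (mw m) s *: 'X_[m])) => // l _.
elim: (m l) => [|k IH]; first by rewrite mulm0n.
rewrite mulmS; apply: PD => //.
rewrite -[l]enum_valK mw_xpoly character_xweight /tsp comp_mpolyXU.
by rewrite -tnth_nth tnth_mktuple enum_rankK.
Qed.

Lemma tsp_is_linear s : linear (tsp s).
Proof. by move=> c p q; rewrite /tsp linearP. Qed.
HB.instance Definition _ s :=
  GRing.isLinear.Build K Kx Kx _ (tsp s) (tsp_is_linear s).

Lemma tspZ s c p : tsp s (c *: p) = c *: tsp s p.
Proof. exact: linearZ. Qed.

Lemma wcpZ b c p : wcp b (c *: p) = c *: wcp b p.
Proof. exact: linearZ. Qed.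

Lemma tsp_wcp s b p : torus_point s -> tsp s (wcp b p) = character b s *: wcp b p.
Proof.
move=> sP; rewrite /wcp raddf_sum scaler_sumr.
apply: eq_bigr => m /eqP <-; rewrite [LHS]tspZ tspX //.
by rewrite !scalerA mulrC.
Qed.

Lemma wcp_tsp s b p : torus_point s -> wcp b (tsp s p) = character b s *: wcp b p.
Proof.
move=> sP; rewrite [p in LHS]mpolyE.
rewrite (raddf_sum (tsp s)) (raddf_sum (wcp b)) /wcp scaler_sumr.
rewrite [RHS]big_mkcond; apply: eq_bigr => m _.
rewrite [LHS](_ : _ = wcp b (tsp s (p@_m *: 'X_[m]))) // tspZ tspX // !wcpZ wcpX.
by case: eqP => [<-|_]; rewrite ?scaler0 // !scalerA mulrC.
Qed.

Lemma tsp_ideal s p : torus_point s ->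
  p \in hyperdet_ideal -> tsp s p \in hyperdet_ideal.
Proof.
move=> sP /asboolP[g ->]; apply/asboolP.
exists (character hyperdet_weight s *: tsp s g).
rewrite /tsp rmorphM /= -!/(tsp _ _) -{1}isobaric_hyperdet tsp_wcp //.
by rewrite isobaric_hyperdet -scalerAr scalerAl.
Qed.

Lemma torus_subst_pi s p : torus_point s -> torus_subst s (\pi_KX p) = \pi_KX (tsp s p).
Proof.
move=> sP; apply/eq_pi; rewrite -linearB; apply: tsp_ideal => //.
by apply/eq_pi; rewrite reprK.
Qed.

Lemma piZ c p : \pi_KX (c *: p) = scalar c * \pi_KX p.
Proof. by rewrite -mul_mpolyC rmorphM. Qed.

Lemma weight_componentP f : weight_decomposition f (weight_component ^~ f).
Proof.
split=> [b s sP|].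
  by rewrite /weight_component torus_subst_pi // tsp_wcp // piZ.
exists (undup [seq mw m | m <- msupp (repr f)]); split; first exact: undup_uniq.
  move=> b; rewrite mem_undup => /mapP hb.
  rewrite /weight_component /wcp big_seq_cond big1 ?rmorph0 // => m /andP[mp /eqP mb].
  by case: hb; exists m.
rewrite -{1}[f]reprK -rmorph_sum /=; congr (\pi_KX _).
rewrite {1}[repr f]mpolyE /wcp (exchange_big_dep xpredT) //= big_seq [RHS]big_seq.
apply: eq_bigr => m mp.
rewrite -big_filter (eq_filter (a2 := pred1 (mw m))); last by move=> b /=; rewrite eq_sym.
rewrite filter_pred1_uniq ?undup_uniq ?big_seq1 // mem_undup.
by apply/mapP; exists m.
Qed.

Lemma weight_componentD b f g :
  weight_component b (f + g) = weight_component b f + weight_component b g.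
Proof.
rewrite -[f]reprK -[g]reprK -rmorphD /= !weight_component_pi.
by rewrite linearD rmorphD.
Qed.

Lemma weight_component_scalar b c f :
  weight_component b (scalar c * f) = scalar c * weight_component b f.
Proof. by rewrite -[f]reprK -piZ !weight_component_pi wcpZ piZ. Qed.

Lemma weight_component_subst b s f : torus_point s ->
  weight_component b (torus_subst s f)
  = scalar (character b s) * weight_component b f.
Proof.
move=> sP; rewrite -[f]reprK torus_subst_pi // !weight_component_pi.
by rewrite wcp_tsp // piZ.
Qed.

Lemma scalarB c d : scalar (c - d) = scalar c - scalar d.
Proof. by rewrite /scalar mpolyCB rmorphB. Qed.

Lemma scalar_inj0 c f : c != 0 -> scalar c * f = 0 -> f = 0.
Proof.
move=> c0 /(congr1 (fun g => scalar c^-1 * g)).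
by rewrite mulr0 mulrA /scalar -rmorphM -mpolyCM mulVf // mpolyC1 rmorph1 mul1r.
Qed.

Lemma character_sep (t : K) (b d : triple int) :
    t != 0 -> (forall n, (0 < n)%N -> t ^+ n != 1) -> b != d ->
  exists2 s, torus_point s & character b s != character d s.
Proof.
move=> t0 tn bd.
have inj (m n : int) : t ^ m = t ^ n -> m = n.
  wlog le_mn : m n / m <= n.
    by move=> W h; case/orP: (le_total m n) => le; [|apply/esym]; apply: W.
  move=> /esym h; have : t ^ (n - m) = 1.
    by rewrite expfzDr // h -expfzDr // subrr expr0z.
  have : 0 <= n - m by rewrite subr_ge0.
  case E : (n - m) => [k|//] _ /eqP; case: k E => [/eqP|k E].
    by rewrite subr_eq0 => /eqP.
  by rewrite -exprnP (negbTE (tn _ _)).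
pose r (k : 'I_2) : 'rV[K]_2 := \row_i (if i == k then t else 1).
pose one : 'rV[K]_2 := \row_i 1.
have r0 k i : r k 0 i != 0 by rewrite mxE; case: ifP => // _; rewrite oner_eq0.
have one0 i : one 0 i != 0 by rewrite mxE oner_eq0.
have Er k (e : 'rV[int]_2) : \prod_i r k 0 i ^ e 0 i = t ^ e 0 k.
  rewrite (bigD1 k) //= mxE eqxx big1 ?mulr1 // => i ik.
  by rewrite mxE (negbTE ik) exp1rz.
have E1 (e : 'rV[int]_2) : \prod_i one 0 i ^ e 0 i = 1.
  by rewrite big1 // => i _; rewrite mxE exp1rz.
case: b d bd => [[b1 b2] b3] [[d1 d2] d3].
have diff (x y : 'rV[int]_2) : x != y -> exists k, x 0 k != y 0 k.
  by move=> xy; apply/existsP; apply: contraR xy => /existsPn h;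
     apply/eqP/rowP => k; apply/eqP; have := h k; rewrite negbK.
rewrite !xpair_eqE !negb_and -orbA => /or3P[] /diff[k hk].
- exists (r k, one, one); first by move=> i; rewrite /= r0 one0.
  by rewrite /character !big_split /= !Er !E1 !mulr1; apply: contra hk => /eqP/inj->.
- exists (one, r k, one); first by move=> i; rewrite /= r0 one0.
  by rewrite /character !big_split /= !Er !E1 !mulr1 !mul1r; apply: contra hk => /eqP/inj->.
- exists (one, one, r k); first by move=> i; rewrite /= r0 one0.
  by rewrite /character !big_split /= !Er !E1 !mul1r; apply: contra hk => /eqP/inj->.
Qed.

Lemma weight_component_vector (t : K) b d f :
    t != 0 -> (forall n, (0 < n)%N -> t ^+ n != 1) ->
  weight_vector d f -> weight_component b f = if b == d then f else 0.
Proof.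
move=> t0 tn hf.
have off c : c != d -> weight_component c f = 0.
  move=> /(character_sep t0 tn)[s sP ne].
  apply: (scalar_inj0 (c := character c s - character d s)); first by rewrite subr_eq0.
  rewrite scalarB mulrBl -weight_component_subst // hf //.
  by rewrite weight_component_scalar subrr.
have [->|/off//] := eqVneq b d.
have [_ [B [Bu hB eB]]] := weight_componentP f.
have [dB|dB] := boolP (d \in B); last first.
  rewrite [RHS]eB hB // big_seq big1 // => c cB; apply: off.
  by apply: contraNneq dB => <-.
by rewrite [RHS]eB (bigD1_seq d) //= big1 ?addr0 // => c; exact: off.
Qed.

(* The decomposition into weight vectors is unique as soon as K contains a
   nonzero element that is not a root of unity. *)
Lemma weight_component_uniq (t : K) f c :
    t != 0 -> (forall n, (0 < n)%N -> t ^+ n != 1) ->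
  weight_decomposition f c -> c = weight_component ^~ f.
Proof.
move=> t0 tn [hc [B [Bu hB ->]]]; apply/funext => b.
have -> : weight_component b (\sum_(i <- B) c i)
    = \sum_(i <- B) if i == b then c b else 0.
  rewrite (big_morph (weight_component b) (weight_componentD b)
    (id1 := 0)); last first.
    by apply: (addrI (weight_component b 0)); rewrite -weight_componentD !addr0.
  apply: eq_bigr => i _; rewrite (weight_component_vector _ t0 tn (hc i)).
  by rewrite eq_sym; case: eqP => // ->.
rewrite -big_mkcond -big_filter.
have [bB|bB] := boolP (b \in B); first by rewrite filter_pred1_uniq // big_seq1.
rewrite hB // big_seq big1 // => i; rewrite mem_filter => /andP[/eqP->].
Qed.

End HyperdetAlgebra.
End HyperdetAlgebra.

From mathcomp Require Import all_classical all_reals all_analysis.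
Import numFieldNormedType.Exports.
Export HyperdetAlgebra.

Local Open Scope classical_set_scope.
Local Open Scope ring_scope.
Local Open Scope ereal_scope.

(* R_infty is the subspace of \bar R of the elements other than -oo.
   If A is a field, w f = +oo only for f = 0, because w f + w f^-1 = w 1 = 0. *)
Definition ring_valuation (R : realType) (A : comNzRingType) (w : A -> \bar R) :=
  [/\ forall f, w f != -oo, w 0%R = +oo, w 1%R = 0,
      forall f g, w (f * g)%R = w f + w g
    & forall f g, mine (w f) (w g) <= w (f + g)%R].

Section HyperdetTropicalization.
Variables (R : realType) (K : fieldType) (v : K -> \bar R).

Definition Xan : set {ptws coord_ring K -> \bar R} :=
  [set w | ring_valuation w /\ forall c, w (scalar c) = v c].

Definition trop (w : coord_ring K -> \bar R) (a : cube) : \bar R := w (coord K a).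

Definition Trop : set (cube -> \bar R) := trop @` Xan.

Definition TropX0 : set {ptws cube -> R} :=
  [set xi | Trop (EFin \o xi)].

Definition pairing (b : triple int) (tau : triple R) : R :=
  (\sum_i ((b.1.1 0 i)%:~R * tau.1.1 0 i + (b.1.2 0 i)%:~R * tau.1.2 0 i
           + (b.2 0 i)%:~R * tau.2 0 i))%R.

(* The infimum is a minimum: f has finitely many nonzero components. *)
Definition mu (tau : triple R) (w : coord_ring K -> \bar R) : {ptws coord_ring K -> \bar R} :=
  fun f => ereal_inf
    [set w (weight_component b f) + (pairing b tau)%:E | b in [set: triple int]].

Definition Zan : set {ptws coord_ring K -> \bar R} :=
  [set mu p.1 p.2 | p in [set: triple R] `*` Xan].

Definition Zan0 : set {ptws coord_ring K -> \bar R} :=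
  [set w | Zan w /\ forall a, trop w a != +oo].

Definition trop_act (tau : triple R) (xi : cube -> R) : {ptws cube -> R} :=
  fun a => (tau.1.1 0 a.1.1 + tau.1.2 0 a.1.2 + tau.2 0 a.2 + xi a)%R.

End HyperdetTropicalization.

(* Main.v *)
(** In every characteristic the linear space [L] of tensors [al_i + be_j + ga_k] lies on
    the hyperdeterminant, and its torus translates give points of [X^an].  For each basis
    of [L] consisting of coordinate functions, a Gauss valuation on the polynomial ring
    in the basis pulls back to a point of [X^an]; among the valuations of [K[L]] taking
    prescribed values on the basis it is the smallest.

    Group the eight vertices of the cube into four antipodal pairs.  [Trop(X^0)] is the
    union of torus translates of a slice lying in [Trop(L)].  The point of the slice in
    the orbit of [xi] is an explicit continuous torus-invariant function of [xi]: with
    [p_i] the sum of [xi] over the i-th pair, the difference between the sums of [xi]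
    over even and odd vertices is distributed over the pairs by water-filling, lowering
    the largest [p_i] first.  The section sends [xi] to the torus translate of the Gauss
    valuation at the slice point.  By minimality, this valuation is the maximum over all
    bases of the (translated) Gauss valuations, a single formula in which continuity and
    equivariance are visible. *)
From mathcomp Require Import fingroup perm.
Require Import Defs.
From mathcomp Require Import all_boot all_order all_algebra.
From mathcomp Require mpoly.
From mathcomp Require Import all_classical all_reals all_analysis.
From mathcomp Require Import lra.
From Stdlib Require Import Ring.
Import Order.TTheory GRing.Theory Num.Theory.
Import numFieldNormedType.Exports.
Import -(notations) mpoly.
Set Implicit Arguments.
Unset Strict Implicit.
Unset Printing Implicit Defensive.
Local Open Scope classical_set_scope.
Local Open Scope ring_scope.
Local Open Scope ereal_scope.

(** * Gauss valuations *)

Section SeqMin.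
Variables (R : realType) (T : eqType).
Implicit Types (s : seq T) (F : T -> \bar R).

Lemma le_seqmin s F (r : \bar R) :
  (r <= \big[mine/+oo]_(i <- s) F i) = all (fun i => r <= F i) s.
Proof. by elim: s => [|i s IH]; rewrite ?big_nil ?leey // big_cons le_min IH. Qed.

Lemma seqmin_attained s F : s != [::] ->
  exists2 i, i \in s & \big[mine/+oo]_(i <- s) F i = F i.
Proof.
elim: s => // i [|j s] IH _; first by exists i; rewrite ?mem_head // big_seq1.
have [k ks Ek] := IH isT; rewrite big_cons Ek minEle.
case: ifP => _; first by exists i; rewrite ?mem_head.
by exists k => //; rewrite inE ks orbT.
Qed.

End SeqMin.

(** * Elementary consequences of the valuation axioms *)

Section Valuation.
Variables (R : realType) (A : comNzRingType) (w : A -> \bar R).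
Hypothesis w_val : ring_valuation w.

Lemma valNy x : w x != -oo. Proof. by have [] := w_val. Qed.
Lemma val0 : w 0%R = +oo. Proof. by have [] := w_val. Qed.
Lemma val1 : w 1%R = 0. Proof. by have [] := w_val. Qed.
Lemma valM x y : w (x * y)%R = w x + w y. Proof. by have [] := w_val. Qed.
Lemma valD x y : mine (w x) (w y) <= w (x + y)%R. Proof. by have [] := w_val. Qed.

Lemma valN x : w (- x)%R = w x.
Proof.
rewrite -mulN1r valM; suff -> : w (-1)%R = 0 by rewrite add0e.
have := valM (-1) (-1); rewrite mulrNN mulr1 val1.
by case: (w _) (valNy (-1)%R) => [r _ [E]||] //; congr _%:E; lra.
Qed.

Lemma val_geD r x y : r <= w x -> r <= w y -> r <= w (x + y)%R.
Proof. by move=> rx ry; apply: le_trans (valD _ _); rewrite le_min rx. Qed.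

Lemma val_gtD r x y : r < w x -> r < w y -> r < w (x + y)%R.
Proof. by move=> rx ry; apply: lt_le_trans (valD _ _); rewrite lt_min rx. Qed.

Lemma val_geB r x y : r <= w x -> r <= w y -> r <= w (x - y)%R.
Proof. by move=> rx ry; apply: val_geD; rewrite ?valN. Qed.

Lemma val_gtB r x y : r < w x -> r < w y -> r < w (x - y)%R.
Proof. by move=> rx ry; apply: val_gtD; rewrite ?valN. Qed.

Lemma val_ge_sum I (s : seq I) (P : pred I) F r :
  (forall i, P i -> r <= w (F i)) -> r <= w (\sum_(i <- s | P i) F i)%R.
Proof.
move=> h; apply: (big_ind (fun x => r <= w x)) => //; first by rewrite val0 leey.
by move=> x y; exact: val_geD.
Qed.

Lemma val_gt_sum I (s : seq I) (P : pred I) F (r : R) :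
  (forall i, P i -> r%:E < w (F i)) -> r%:E < w (\sum_(i <- s | P i) F i)%R.
Proof.
move=> h; apply: (big_ind (fun x => r%:E < w x)) => //; first by rewrite val0 ltry.
by move=> x y; exact: val_gtD.
Qed.

(** Cancellation is ruled out by the ultrametric inequality for [x = (x + y) - y]. *)
Lemma val_addl x y : w x < w y -> w (x + y)%R = w x.
Proof.
move=> xy; apply/eqP; rewrite eq_le val_geD ?(ltW xy) // andbT leNgt.
apply/negP => h; have := val_gtB h xy.
by rewrite addrK ltxx.
Qed.

Lemma val_natr n : 0 <= w n%:R%R.
Proof.
elim: n => [|n IH]; first by rewrite val0 leey.
by rewrite -natr1 val_geD // val1.
Qed.

Lemma val_prod I (s : seq I) (F : I -> A) :
  w (\prod_(i <- s) F i)%R = \sum_(i <- s) w (F i).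
Proof. by apply: (big_morph _ valM val1). Qed.

End Valuation.

Section GaussValuation.
Variables (R : realType) (K : fieldType) (v : K -> \bar R).
Hypothesis v_val : ring_valuation v.

Lemma val_fin_num c : c != 0%R -> v c \is a fin_num.
Proof.
move=> c0; have := valM v_val c c^-1; rewrite divff // (val1 v_val).
by case: (v c) (valNy v_val c) (v c^-1) (valNy v_val c^-1) => [//| |//] _ [].
Qed.

Variable n : nat.
Implicit Types (f g : mpoly n K) (m : multinom n) (eta : 'I_n -> R).

Definition mnm_pairing eta m : R := (\sum_i eta i *+ m i)%R.

Lemma mnm_pairingD eta m1 m2 :
  mnm_pairing eta (mnm_add m1 m2) = (mnm_pairing eta m1 + mnm_pairing eta m2)%R.
Proof. by rewrite -big_split; apply: eq_bigr => i _; rewrite mnmDE mulrnDr. Qed.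

Definition gauss_term eta f m := v (mcoeff m f) + (mnm_pairing eta m)%:E.

Definition gauss eta f := \big[mine/+oo]_(m <- msupp f) gauss_term eta f m.

(** Monomials outside the support have value [+oo], so all monomials may be quantified over and
    supports of sums and products need not be tracked. *)
Lemma le_gaussP eta f r :
  r <= gauss eta f <-> forall m, r <= gauss_term eta f m.
Proof.
rewrite le_seqmin; split=> [/allP h m|h]; last by apply/allP.
have [/h//|/memN_msupp_eq0 f0] := boolP (m \in msupp f).
by rewrite /gauss_term f0 (val0 v_val) addye ?leey.
Qed.

Lemma gauss_le eta f m : gauss eta f <= gauss_term eta f m.
Proof. exact: (proj1 (le_gaussP eta f (gauss eta f)) (lexx _)). Qed.

Lemma gauss_attained eta f : f != 0%R ->
  exists2 m, m \in msupp f & gauss eta f = gauss_term eta f m.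
Proof. by rewrite -msupp_eq0; exact: seqmin_attained. Qed.

Lemma gauss_fin_num eta f : f != 0%R -> gauss eta f \is a fin_num.
Proof.
move=> /(gauss_attained eta)[m mf ->].
by rewrite fin_numD val_fin_num -?mcoeff_msupp.
Qed.

Lemma gauss0 eta : gauss eta 0%R = +oo.
Proof. by rewrite /gauss msupp0 big_nil. Qed.

Lemma gaussC eta c : gauss eta (mpolyC n c) = v c.
Proof.
have E : gauss_term eta (mpolyC n c) mnm0 = v c.
  rewrite /gauss_term mcoeffC eqxx mulr1 /mnm_pairing big1 ?adde0 // => i _.
  by rewrite mnm0E.
apply/eqP; rewrite eq_le -{1}E gauss_le /=; apply/le_gaussP => m.
rewrite /gauss_term mcoeffC; have [->|_] := eqVneq m mnm0; last first.
  by rewrite mulr0 (val0 v_val) addye ?leey.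
by rewrite mulr1 /mnm_pairing big1 ?adde0 // => i _; rewrite mnm0E.
Qed.

Lemma gaussD eta f g : mine (gauss eta f) (gauss eta g) <= gauss eta (f + g)%R.
Proof.
apply/le_gaussP => m; rewrite /gauss_term mcoeffD.
rewrite -leeBlDr //; apply: (val_geD v_val); rewrite leeBlDr // ge_min.
  by rewrite (gauss_le eta f m).
by rewrite (gauss_le eta g m) orbT.
Qed.

Lemma gauss_mul_ge eta f g : gauss eta f + gauss eta g <= gauss eta (f * g)%R.
Proof.
apply/le_gaussP => m; rewrite /gauss_term mcoeffM.
rewrite -leeBlDr //; apply: (val_ge_sum v_val) => k /eqP mE.
rewrite (valM v_val) leeBlDr // (congr1 (mnm_pairing eta) mE) mnm_pairingD.
rewrite EFinD addeACA.
by apply: leeD; exact: gauss_le.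
Qed.

(** Gauss's lemma. [low h] collects the terms of least value; in [f * g] everything outside
    [low f * low g] has strictly larger Gauss value. *)
Lemma gaussM eta f g : gauss eta (f * g)%R = gauss eta f + gauss eta g.
Proof.
have [->|f0] := eqVneq f 0%R.
  rewrite mul0r gauss0 addye //.
  have [->|g0] := eqVneq g 0%R; first by rewrite gauss0.
  by have := gauss_fin_num eta g0; rewrite fin_numE => /andP[].
have [->|g0] := eqVneq g 0%R.
  rewrite mulr0 gauss0 addey //.
  by have := gauss_fin_num eta f0; rewrite fin_numE => /andP[].
pose low h : mpoly n K :=
  (\sum_(m <- msupp h | gauss_term eta h m == gauss eta h)
     mcoeff m h *: mpolyX K m)%R.
have lowE h m : mcoeff m (low h) =
    if (m \in msupp h) && (gauss_term eta h m == gauss eta h)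
    then mcoeff m h else 0%R.
  rewrite /low raddf_sum /= -big_filter.
  have [mh|mh] := boolP ((m \in msupp h) && (gauss_term eta h m == gauss eta h)).
    rewrite (bigD1_seq m) ?filter_uniq ?msupp_uniq //=; last first.
      by rewrite mem_filter andbC.
    rewrite mcoeffZ mcoeffX eqxx mulr1 big1 ?addr0 // => k /negbTE km.
    by rewrite mcoeffZ mcoeffX km mulr0.
  rewrite big_seq big1 // => k; rewrite mem_filter => kh.
  rewrite mcoeffZ mcoeffX; case: eqP => [km|]; last by rewrite mulr0.
  by move: mh; rewrite -km andbC kh.
have highE h : h != 0%R -> gauss eta h < gauss eta (h - low h)%R.
  move=> h0; have [->|d0] := eqVneq (h - low h)%R 0%R.
    by rewrite gauss0; have := gauss_fin_num eta h0; rewrite fin_numElt => /andP[].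
  have [m] := gauss_attained eta d0.
  rewrite mcoeff_msupp /gauss_term mcoeffB lowE.
  case: ifP => [|mh]; first by rewrite subrr eqxx.
  rewrite subr0 => mh0 ->; rewrite lt_neqAle gauss_le andbT eq_sym.
  by move: mh; rewrite mcoeff_msupp mh0 /= => ->.
have low_lead h : h != 0%R ->
    gauss eta h = gauss_term eta (low h) (mlead (low h)) /\ gauss eta h <= gauss eta (low h).
  move=> h0; have l0 : low h != 0%R.
    have [m mh Em] := gauss_attained eta h0.
    apply/eqP => /(congr1 (mcoeff m)); rewrite lowE mh -Em eqxx mcoeff0 => /eqP.
    by rewrite -[_ == _]negbK -mcoeff_msupp mh.
  split; last first.
    apply/le_gaussP => m; rewrite /gauss_term lowE.
    by case: ifP => _; rewrite ?(val0 v_val) ?addye ?leey ?gauss_le.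
  have := mlead_supp l0; rewrite mcoeff_msupp /gauss_term lowE.
  by case: ifP => [/andP[_ /eqP<-]|]; rewrite ?eqxx.
have [lf llf] := low_lead _ f0; have [lg llg] := low_lead _ g0.
apply/eqP; rewrite eq_le gauss_mul_ge // andbT.
(* Leading monomials multiply without cancellation, so at this monomial [low f * low g] has exactly
   the expected value. *)
apply: (le_trans (gauss_le eta _ (mnm_add (mlead (low f)) (mlead (low g))))).
set m := mnm_add _ _.
have fgE : (f * g = low f * low g + ((f - low f) * low g + f * (g - low g)))%R.
  by rewrite addrA -mulrDl [(low f + _)%R]addrC subrK mulrBr addrC subrK.
rewrite /gauss_term fgE mcoeffD.
have low_m : v (mcoeff m (low f * low g)) + (mnm_pairing eta m)%:E =
    gauss eta f + gauss eta g.
  by rewrite lf lg mleadcM (valM v_val) mnm_pairingD EFinD addeACA.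
rewrite (val_addl v_val) ?low_m //.
rewrite -(lteD2rE _ _ (x := (mnm_pairing eta m)%:E)) // low_m.
have : gauss eta f + gauss eta g < gauss eta ((f - low f) * low g + f * (g - low g))%R.
  apply: lt_le_trans (gaussD _ _ _); rewrite lt_min; apply/andP; split.
  - apply: lt_le_trans (gauss_mul_ge _ _ _); rewrite lte_leD // ?highE //.
    exact: gauss_fin_num.
  - apply: lt_le_trans (gauss_mul_ge _ _ _); rewrite lee_ltD // ?highE //.
    exact: gauss_fin_num.
by move/lt_le_trans; apply; exact: gauss_le.
Qed.

Lemma gauss_val eta : ring_valuation (gauss eta).
Proof.
split; first 1 last.
- exact: gauss0.
- by rewrite -mpolyC1 gaussC (val1 v_val).
- exact: gaussM.
- exact: gaussD.
- move=> f; have [->|/(gauss_fin_num eta)] := eqVneq f 0%R; first by rewrite gauss0.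
  by rewrite fin_numE => /andP[].
Qed.

(** The ultrametric inequality, monomial by monomial. This minimality of the Gauss valuation is what
    allows different bases to be compared. *)
Lemma gauss_le_comp (A : comNzRingType) (w : A -> \bar R) (iota : {rmorphism K -> A})
    (h : 'I_n -> A) eta :
    ring_valuation w -> (forall c, w (iota c) = v c) ->
    (forall k, (eta k)%:E <= w (h k)) ->
  forall f, gauss eta f <= w (mmap iota h f).
Proof.
move=> w_val wv wh f; apply: (val_ge_sum w_val) => m _.
rewrite (valM w_val) wv; apply: (le_trans (gauss_le eta f m)).
apply: leeD2l; rewrite /mmap1 (val_prod w_val) /mnm_pairing -sumEFin.
apply: lee_sum => i _; elim: (m i) => [|k IH].
  by rewrite mulr0n expr0 (val1 w_val).
by rewrite mulrS exprS (valM w_val) EFinD leeD.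
Qed.

End GaussValuation.

(** * Torus weights and pullbacks *)

Section TorusAction.
Variables (R : realType) (K : fieldType).
Implicit Types (f : coord_ring K) (b : triple int) (tau : triple R).
Implicit Types (w : coord_ring K -> \bar R).

(** Read off from a chosen representative, so some listed weights may have zero component; what
    matters is that no weight with nonzero component is missed. *)
Definition weights f : seq (triple int) :=
  undup [seq monomial_weight m | m <- msupp (repr f)].

Lemma weight_component0 b f : b \notin weights f -> weight_component b f = 0%R.
Proof.
rewrite mem_undup => /mapP hb; rewrite /weight_component /weight_component_poly.
rewrite big_seq_cond big1 ?rmorph0 // => m /andP[mf /eqP mb].
by case: hb; exists m.
Qed.

Lemma weight_component_idem b b' f :
  weight_component b' (weight_component b f) =
  if b' == b then weight_component b f else 0%R.
Proof.
rewrite -[f]reprK; move: (repr f) => p.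
rewrite [weight_component b _]weight_component_pi weight_component_pi.
have -> : weight_component_poly b' (weight_component_poly b p) =
    if b' == b then weight_component_poly b p else 0%R.
  apply/mpolyP => m; rewrite mcoeff_wcp.
  have [->|b'b] := eqVneq b' b; first by rewrite mcoeff_wcp; case: eqP.
  rewrite mcoeff_wcp mcoeff0; case: eqP => // ->; rewrite (negbTE b'b) //.
by case: ifP => _ //; rewrite rmorph0.
Qed.

Lemma weight_component_coord b a :
  weight_component b (HyperdetAlgebra.coord K a) = if b == xweight a then HyperdetAlgebra.coord K a else 0%R.
Proof.
rewrite /HyperdetAlgebra.coord weight_component_pi /xpoly wcpX mw_xpoly eq_sym.
by case: ifP; rewrite ?rmorph0.
Qed.

Lemma pairingDl b b' tau : pairing (b + b')%R tau = (pairing b tau + pairing b' tau)%R.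
Proof.
rewrite /pairing -big_split; apply: eq_bigr => i _ /=.
by rewrite !mxE !intrD !mulrDl; lra.
Qed.

Lemma pairingDr b tau tau' :
  pairing b (tau + tau')%R = (pairing b tau + pairing b tau')%R.
Proof.
rewrite /pairing -big_split; apply: eq_bigr => i _ /=.
by rewrite !mxE !mulrDr; lra.
Qed.

Lemma pairing0l tau : pairing 0%R tau = 0%R.
Proof. by rewrite /pairing big1 // => i _; rewrite !mxE !mul0r !addr0. Qed.

Lemma pairing_xweight a tau :
  pairing (xweight a) tau = (tau.1.1 0 a.1.1 + tau.1.2 0 a.1.2 + tau.2 0 a.2)%R.
Proof.
have E (r : 'rV[R]_2) k : (\sum_i ((delta_mx 0 k : 'rV[int]_2) 0 i)%:~R * r 0 i = r 0 k)%R.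
  rewrite (bigD1 k) //= mxE !eqxx mul1r big1 ?addr0 // => i ik.
  by rewrite mxE (negbTE ik) andbF mul0r.
by rewrite /pairing !big_split /= !E.
Qed.

Lemma trop_actE tau xi a : trop_act tau xi a = (pairing (xweight a) tau + xi a)%R.
Proof. by rewrite pairing_xweight. Qed.

Lemma pairing_monomial_weight tau tau' m :
    (forall a, pairing (xweight a) tau = pairing (xweight a) tau') ->
  pairing (monomial_weight m) tau = pairing (monomial_weight m) tau'.
Proof.
move=> h; pose P m := pairing (monomial_weight m) tau = pairing (monomial_weight m) tau'.
have P0 : P mnm0.
  have E : monomial_weight mnm0 = 0%R.
    by apply: (addrI (monomial_weight mnm0)); rewrite addr0 -monomial_weightD addm0.
  by rewrite /P E !pairing0l.
have PD m1 m2 : P m1 -> P m2 -> P (mnm_add m1 m2).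
  by rewrite /P monomial_weightD !pairingDl => -> ->.
rewrite -/(P m) [m]multinomUE_id; apply: big_ind => // l _.
elim: (m l) => [|k IH]; first by rewrite mulm0n.
by rewrite mulmS; apply: PD => //; rewrite /P -[l]enum_valK mw_xpoly.
Qed.

Lemma mu_term_top w b f tau : w 0%R = +oo -> b \notin weights f ->
  w (weight_component b f) + (pairing b tau)%:E = +oo.
Proof. by move=> w0 /weight_component0 ->; rewrite w0 addye. Qed.

(** The finite list depends on neither [tau] nor [w], so continuity of [mu] reduces to that of
    finite minima. *)
Lemma mu_seqmin tau w f : w 0%R = +oo ->
  mu tau w f = \big[mine/+oo]_(b <- weights f)
                 (w (weight_component b f) + (pairing b tau)%:E).
Proof.
move=> w0; apply/eqP; rewrite eq_le; apply/andP; split.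
  by rewrite le_seqmin; apply/allP => b _; apply: ereal_inf_lbound; exists b.
apply: le_ereal_inf_tmp => _ [b _ <-].
have [bf|bf] := boolP (b \in weights f); last by rewrite mu_term_top ?leey.
have := lexx (\big[mine/+oo]_(b <- weights f)
  (w (weight_component b f) + (pairing b tau)%:E)).
by rewrite le_seqmin => /allP/(_ b bf).
Qed.

Lemma mu_weight_vector tau w b f : w 0%R = +oo ->
    (forall b', weight_component b' f = if b' == b then f else 0%R) ->
  mu tau w f = w f + (pairing b tau)%:E.
Proof.
move=> w0 hf; apply/eqP; rewrite eq_le; apply/andP; split.
  by apply: ereal_inf_lbound; exists b => //; rewrite hf eqxx.
apply: le_ereal_inf_tmp => _ [b' _ <-]; rewrite hf.
by case: eqP => [->//|_]; rewrite w0 addye ?leey.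
Qed.

Lemma mu_coord tau w a : w 0%R = +oo ->
  mu tau w (HyperdetAlgebra.coord K a) = w (HyperdetAlgebra.coord K a) + (pairing (xweight a) tau)%:E.
Proof. by move=> w0; apply: mu_weight_vector => // b; exact: weight_component_coord. Qed.

(** The component maps are orthogonal idempotents, so [mu tau'] only adds a constant on each weight
    space. *)
Lemma mu_mu tau tau' w : w 0%R = +oo -> mu tau (mu tau' w) = mu (tau + tau')%R w.
Proof.
move=> w0; apply/funext => f; rewrite /mu; congr ereal_inf.
apply: eq_imagel => b _; rewrite -/(mu tau' w (weight_component b f)).
rewrite (@mu_weight_vector _ _ b) //; last by move=> b'; exact: weight_component_idem.
by rewrite pairingDr EFinD -addeA [(pairing b tau)%:E + _]addeC.
Qed.

(** Monomial weights are sums of coordinate weights, so [mu] ignores parameters that shift no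
    coordinate. This is needed because [slice_torus] is equivariant only modulo such parameters. *)
Lemma eq_mu tau tau' w : w 0%R = +oo ->
    (forall a, pairing (xweight a) tau = pairing (xweight a) tau') ->
  mu tau w = mu tau' w.
Proof.
move=> w0 h; apply/funext => f; rewrite /mu; congr ereal_inf.
apply: eq_imagel => b _.
have [|bf] := boolP (b \in weights f); last by rewrite !mu_term_top.
by rewrite mem_undup => /mapP[m _ ->]; rewrite (pairing_monomial_weight _ h).
Qed.

Lemma le_mu tau w w' : (forall f, w f <= w' f) -> forall f, mu tau w f <= mu tau w' f.
Proof.
move=> h f; apply: le_ereal_inf_tmp => _ [b _ <-].
by apply: (le_trans _ (leeD2r _ (h _))); apply: ereal_inf_lbound; exists b.
Qed.

End TorusAction.

(** * Points of [Xan] from evaluations that kill the hyperdeterminant *)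

Section Pullback.
Variables (R : realType) (K : fieldType) (A : comNzRingType).
Variables (iota : {rmorphism K -> A}) (y : cube -> A).

Definition cube_eval (p : mpoly #|{: cube}| K) : A := mmap iota (y \o enum_val) p.

Lemma cube_eval_xpoly a : cube_eval (xpoly K a) = y a.
Proof. by rewrite /cube_eval /xpoly mmapX mmap1U /= enum_rankK. Qed.

Lemma cube_eval_const c : cube_eval (mpolyC _ c) = iota c.
Proof. exact: mmapC. Qed.

Hypothesis hyperdet_y : cube_eval (hyperdet K) = 0%R.
Variables (w : A -> \bar R).

Definition pullback (f : coord_ring K) : \bar R := w (cube_eval (repr f)).

(** Two representatives differ by a multiple of the hyperdeterminant, which evaluates to zero. *)
Lemma pullback_pi p : pullback (\pi_(coord_ring K)%qT p) = w (cube_eval p).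
Proof.
rewrite /pullback; congr w; apply/eqP; rewrite -subr_eq0 /cube_eval -mmapB.
have /eq_pi/asboolP[g ->] : \pi_(coord_ring K)%qT (repr (\pi_(coord_ring K)%qT p)) =
    \pi_(coord_ring K)%qT p by rewrite reprK.
by rewrite rmorphM /= -!/(cube_eval _) hyperdet_y mulr0.
Qed.

Lemma pullback_coord a : pullback (HyperdetAlgebra.coord K a) = w (y a).
Proof. by rewrite pullback_pi cube_eval_xpoly. Qed.

Lemma pullback_val : ring_valuation w -> ring_valuation pullback.
Proof.
move=> w_val; split.
- by move=> f; exact: (valNy w_val).
- by rewrite -(rmorph0 (\pi_(coord_ring K)%qT)) pullback_pi /cube_eval rmorph0 (val0 w_val).
- by rewrite -(rmorph1 (\pi_(coord_ring K)%qT)) pullback_pi /cube_eval rmorph1 (val1 w_val).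
- move=> f g; rewrite -[f]reprK -[g]reprK -rmorphM !pullback_pi /cube_eval.
  by rewrite rmorphM (valM w_val).
- move=> f g; rewrite -[f]reprK -[g]reprK -rmorphD !pullback_pi /cube_eval.
  by rewrite rmorphD (valD w_val).
Qed.

Lemma pullback_Xan (v : K -> \bar R) : ring_valuation w ->
  (forall c, w (iota c) = v c) -> Xan v pullback.
Proof.
move=> w_val wv; split; first exact: pullback_val.
by move=> c; rewrite pullback_pi cube_eval_const.
Qed.

End Pullback.

(** * Bases of the linear space of tensors [al_i + be_j + ga_k] *)

Notation o0 := (@Ordinal 4 0 isT).
Notation o1 := (@Ordinal 4 1 isT).
Notation o2 := (@Ordinal 4 2 isT).
Notation o3 := (@Ordinal 4 3 isT).

Lemma ord4_ind (P : 'I_4 -> Prop) : P o0 -> P o1 -> P o2 -> P o3 -> forall i, P i.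
Proof.
move=> p0 p1 p2 p3 [[|[|[|[|//]]]] h].
- by rewrite (_ : Ordinal h = o0) //; apply: val_inj.
- by rewrite (_ : Ordinal h = o1) //; apply: val_inj.
- by rewrite (_ : Ordinal h = o2) //; apply: val_inj.
- by rewrite (_ : Ordinal h = o3) //; apply: val_inj.
Qed.

Lemma big_ord4 (T : Type) (idx : T) (op : Monoid.law idx) (F : 'I_4 -> T) :
  \big[op/idx]_(i < 4) F i = op (op (op (F o0) (F o1)) (F o2)) (F o3).
Proof.
rewrite !big_ord_recr big_ord0 Monoid.mul1m /=.
by congr (op (op (op (F _) (F _)) (F _)) (F _)); apply: val_inj.
Qed.

(* The four main diagonals of the cube are indexed by ['I_4]; the boolean is the parity
   of the vertex, so [vertex i false] and [vertex i true] are antipodal. *)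
Definition vertex (i : 'I_4) (e : bool) : cube :=
  match val i, e with
  | 0%N, false => (0, 0, 0) | 0%N, true => (1, 1, 1)
  | 1%N, false => (1, 1, 0) | 1%N, true => (0, 0, 1)
  | 2%N, false => (1, 0, 1) | 2%N, true => (0, 1, 0)
  | _, false => (0, 1, 1) | _, true => (1, 0, 0)
  end%R.

Definition parity (a : cube) : bool :=
  (a.1.1 == 1%R) (+) (a.1.2 == 1%R) (+) (a.2 == 1%R).

Definition diagonal (a : cube) : 'I_4 :=
  match (a.1.1 == 1%R) (+) parity a, (a.1.2 == 1%R) (+) parity a with
  | false, false => o0 | true, true => o1 | true, false => o2 | false, true => o3
  end.

Lemma diagonal_vertex i e : diagonal (vertex i e) = i.
Proof. by elim/ord4_ind: i; case: e. Qed.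

Lemma parity_vertex i e : parity (vertex i e) = e.
Proof. by elim/ord4_ind: i; case: e. Qed.

Lemma I2P (i : 'I_2) : i = 0%R \/ i = 1%R.
Proof. by case: i => [[|[|//]] h]; [left|right]; apply: val_inj. Qed.

Lemma vertexK a : vertex (diagonal a) (parity a) = a.
Proof.
by case: a => [[i j] k]; case: (I2P i) => ->; case: (I2P j) => ->; case: (I2P k) => ->.
Qed.

(** * Polynomial identities, over an abstract [ring_theory] so that [ring] decides them *)

Section AbstractRing.
Variables (T : Type) (zero one : T) (add mul sub : T -> T -> T) (opp : T -> T).
Hypothesis T_ring : ring_theory zero one add mul sub opp eq.
Add Ring abstract_ring : T_ring.
Local Notation "x + y" := (add x y).
Local Notation "x - y" := (sub x y).
Local Notation "x * y" := (mul x y).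
Local Notation "2" := (one + one).

(** Letters stand for diagonals and digits for parities. The regrouped form makes the symmetry in
    the diagonals and in the parities visible. *)
Lemma hyperdet_identity a0 a1 b0 b1 c0 c1 d0 d1 :
  let p := a0 * a1 in let q := b0 * b1 in let r := c0 * c1 in let s := d0 * d1 in
  let t := p + q + r + s in
  2 * (p * p + q * q + r * r + s * s) - t * t
    + 2 * 2 * (a0 * b0 * c0 * d0 + a1 * b1 * c1 * d1) =
  a0 * a0 * (a1 * a1) + b1 * b1 * (b0 * b0)
  + c1 * c1 * (c0 * c0) + d1 * d1 * (d0 * d0)
  - 2 * a0 * b1 * b0 * a1 - 2 * a0 * c1 * c0 * a1 - 2 * a0 * d0 * d1 * a1
  - 2 * b1 * c1 * c0 * b0 - 2 * b1 * d0 * b0 * d1 - 2 * c1 * d0 * c0 * d1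
  + 2 * 2 * a0 * d0 * c0 * b0 + 2 * 2 * b1 * c1 * d1 * a1.
Proof. by cbv zeta; ring. Qed.

Lemma hyperdet_linear_identity a b c s :
  let d := (s + s) - (a + b + c) in
  let p := a * (s - a) in let q := b * (s - b) in
  let r := c * (s - c) in let u := d * (s - d) in
  let t := p + q + r + u in
  2 * (p * p + q * q + r * r + u * u) - t * t
    + 2 * 2 * (a * b * c * d + (s - a) * (s - b) * (s - c) * (s - d)) = zero.
Proof. by cbv zeta; ring. Qed.

(** This and [path_identity] serve the two shapes of basis: the reconstructed entries of lower
    parity sum to twice the antipodal sum. *)
Lemma star_identity z0 z1 z2 z3 :
  let s := z1 + z2 + z3 - z0 in z0 + (s - z1) + (s - z2) + (s - z3) = s + s.
Proof. by cbv zeta; ring. Qed.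

Lemma path_identity z0 z1 z2 z3 :
  let s := z2 + z3 in z0 + (z3 - z0 + z1) + (s - z1) + z2 = s + s.
Proof. by cbv zeta; ring. Qed.

Lemma complement_identity a b c d s : a + b + c + d = s + s ->
  (s - a) + (s - b) + (s - c) + (s - d) = s + s.
Proof.
move=> h; transitivity ((s + s) + (s + s) - (a + b + c + d)); first by ring.
by rewrite h; ring.
Qed.

Lemma star_sum_identity a b c d s : a + b + c + d = s + s ->
  (s - b) + (s - c) + (s - d) - a = s.
Proof.
move=> h; transitivity (s + (s + s) - (a + b + c + d)); first by ring.
by rewrite h; ring.
Qed.

Lemma path_low_identity a b c d s : a + b + c + d = s + s ->
  (s - d) - a + (s - c) = b.
Proof.
move=> h; transitivity ((s + s) - (a + b + c + d) + b); first by ring.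
by rewrite h; ring.
Qed.

(** This and [isolate_identity] solve the hyperdeterminant for the one term that might be a lone
    tropical minimum. *)
Lemma isolate_parity_identity s q a b :
  2 * 2 * a - (s * s - 2 * q - 2 * 2 * b) = 2 * q - s * s + 2 * 2 * (a + b).
Proof. by ring. Qed.

Lemma isolate_identity p t q a b :
  p * p - (p * t + p * t + t * t - 2 * q - (2 * 2 * a + 2 * 2 * b)) =
  2 * (p * p + q) - (p + t) * (p + t) + 2 * 2 * (a + b).
Proof. by ring. Qed.

End AbstractRing.

Section RingIdentities.
Variable A : comNzRingType.
Local Open Scope ring_scope.

Lemma comring_theory :
  ring_theory (0 : A) 1 +%R *%R (fun x y => x - y) -%R eq.
Proof.
split; [exact: add0r | exact: addrC | exact: addrA | exact: mul1r | exact: mulrC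
  | exact: mulrA | exact: mulrDl | by [] | exact: subrr].
Qed.

Definition diag_prod (y : cube -> A) i := y (vertex i false) * y (vertex i true).

Definition paired_hyperdet (y : cube -> A) :=
  let S := \sum_i diag_prod y i in
  2%:R * (\sum_i diag_prod y i * diag_prod y i) - S * S
  + 2%:R * 2%:R * (\prod_i y (vertex i false) + \prod_i y (vertex i true)).

Lemma paired_hyperdetE y :
  paired_hyperdet y = let x i j k := y (i, j, k) in
  x 0 0 0 ^+ 2 * x 1 1 1 ^+ 2 + x 0 0 1 ^+ 2 * x 1 1 0 ^+ 2
  + x 0 1 0 ^+ 2 * x 1 0 1 ^+ 2 + x 1 0 0 ^+ 2 * x 0 1 1 ^+ 2
  - 2 * x 0 0 0 * x 0 0 1 * x 1 1 0 * x 1 1 1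
  - 2 * x 0 0 0 * x 0 1 0 * x 1 0 1 * x 1 1 1
  - 2 * x 0 0 0 * x 0 1 1 * x 1 0 0 * x 1 1 1
  - 2 * x 0 0 1 * x 0 1 0 * x 1 0 1 * x 1 1 0
  - 2 * x 0 0 1 * x 0 1 1 * x 1 1 0 * x 1 0 0
  - 2 * x 0 1 0 * x 0 1 1 * x 1 0 1 * x 1 0 0
  + 4 * x 0 0 0 * x 0 1 1 * x 1 0 1 * x 1 1 0
  + 4 * x 0 0 1 * x 0 1 0 * x 1 0 0 * x 1 1 1.
Proof.
rewrite /paired_hyperdet /diag_prod /= !big_ord4 /vertex /= !expr2.
rewrite (_ : 4%:R = (1 + 1) * (1 + 1) :> A); last by rewrite -mulr2n -natrM.
rewrite !mulr2n.
exact: (hyperdet_identity comring_theory).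
Qed.

(* The hypotheses describe the tensors [al_i + be_j + ga_k]. *)
Lemma paired_hyperdet_linear (y : cube -> A) (S : A) :
    (forall i, y (vertex i false) + y (vertex i true) = S) ->
    (\sum_i y (vertex i false) = S + S) ->
  paired_hyperdet y = 0.
Proof.
move=> hS; rewrite /paired_hyperdet /diag_prod /= !big_ord4.
have E i : y (vertex i true) = S - y (vertex i false) by rewrite -(hS i) addrAC subrr add0r.
rewrite !E => h.
have -> : y (vertex o3 false) = S + S - (y (vertex o0 false)
    + y (vertex o1 false) + y (vertex o2 false)).
  by rewrite -h addrAC subrr add0r.
rewrite !mulr2n.
exact: (hyperdet_linear_identity comring_theory).
Qed.

End RingIdentities.

Lemma hyperdet_paired (K : fieldType) : hyperdet K = paired_hyperdet (xpoly K).
Proof. by rewrite paired_hyperdetE. Qed.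

Lemma cube_eval_hyperdet (K : fieldType) (A : comNzRingType)
    (iota : {rmorphism K -> A}) (y : cube -> A) :
  cube_eval iota y (hyperdet K) = paired_hyperdet y.
Proof.
rewrite hyperdet_paired /cube_eval /paired_hyperdet /diag_prod /=.
rewrite !big_ord4 /= !(rmorphD, rmorphN, rmorphM, rmorph1, rmorphMn) /=.
by rewrite -!/(cube_eval _ _ _) !cube_eval_xpoly.
Qed.

(** * Reconstruction of a tensor of the linear space from its entries on a cell *)

Section Cells.

(* A cell is a basis of the linear space of the [al_i + be_j + ga_k] made of coordinates.
   The permutation lists the diagonals by increasing tropical weight and the boolean
   [cell_parity] is the parity of lower tropical weight.  A star consists of a vertex and
   the vertices adjacent to it; otherwise the basis is the path
   high [s 3], low [s 0], high [s 2], low [s 3]. *)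
Definition cell := ({perm 'I_4} * bool * bool)%type.
Definition cell_order (c : cell) : {perm 'I_4} := c.1.1.
Definition cell_parity (c : cell) : bool := c.1.2.
Definition cell_star (c : cell) : bool := c.2.

Definition cell_basis (c : cell) (k : 'I_4) : cube :=
  let s := cell_order c in let e := cell_parity c in
  if cell_star c then vertex (s k) (if k == o0 then e else ~~ e) else
  match val k with
  | 0%N => vertex (s o0) e | 1%N => vertex (s o2) (~~ e)
  | 2%N => vertex (s o3) e | _ => vertex (s o3) (~~ e)
  end.

Local Open Scope ring_scope.

Section Reconstruction.
Variables (A : comNzRingType) (c : cell).
Implicit Types (z : 'I_4 -> A) (y : cube -> A).

Definition antipode_sum z : A :=
  if cell_star c then z o1 + z o2 + z o3 - z o0 else z o2 + z o3.

(** In the path, no vertex of the diagonal [s o1] belongs to the basis; its entry is forced by the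
    sum of the four entries of lower parity. *)
Definition low_coord z (k : 'I_4) : A :=
  if cell_star c then if k == o0 then z o0 else antipode_sum z - z k else
  match val k with
  | 0%N => z o0 | 1%N => z o3 - z o0 + z o1
  | 2%N => antipode_sum z - z o1 | _ => z o2
  end.

Definition cube_of_basis z (a : cube) : A :=
  let l := low_coord z ((cell_order c)^-1%g (diagonal a)) in
  if parity a == cell_parity c then l else antipode_sum z - l.

(** Both parities are listed because either one can be the lower parity of a cell. *)
Definition linear_cube y s :=
  (forall i, y (vertex i false) + y (vertex i true) = s) /\
  forall e, \sum_i y (vertex i e) = s + s.

Lemma cube_of_basis_vertex z k e :
  cube_of_basis z (vertex (cell_order c k) e) =
  if e == cell_parity c then low_coord z k else antipode_sum z - low_coord z k.
Proof. by rewrite /cube_of_basis diagonal_vertex parity_vertex permK. Qed.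

Lemma low_coord_sum z : \sum_k low_coord z k = antipode_sum z + antipode_sum z.
Proof.
rewrite big_ord4 /low_coord /antipode_sum; case: (cell_star c) => /=.
  exact: (star_identity (comring_theory A)).
exact: (path_identity (comring_theory A)).
Qed.

Lemma cube_of_basis_linear z : linear_cube (cube_of_basis z) (antipode_sum z).
Proof.
split=> [i|e].
  rewrite -(permKV (cell_order c) i) !cube_of_basis_vertex.
  by case: (cell_parity c) => /=; rewrite ?subrK // addrC subrK.
rewrite (reindex_inj (@perm_inj _ (cell_order c))) /=.
under eq_bigr do rewrite cube_of_basis_vertex.
case: eqP => _; first exact: low_coord_sum.
have := low_coord_sum z; rewrite !big_ord4 /=.
exact: (complement_identity (comring_theory A)).
Qed.

(** The antipodal sum is recovered first, then the lower entries. Applied to the generic point of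
    another cell, this is a change of basis. *)
Lemma cube_of_basisK y s : linear_cube y s -> cube_of_basis (y \o cell_basis c) =1 y.
Proof.
move=> [hS hsum] a.
pose l k := y (vertex (cell_order c k) (cell_parity c)).
have yh k : y (vertex (cell_order c k) (~~ cell_parity c)) = s - l k.
  by rewrite /l -(hS (cell_order c k)); case: (cell_parity c) => /=;
     rewrite ?addrK // addrAC subrr add0r.
have hl : l o0 + l o1 + l o2 + l o3 = s + s.
  by rewrite -(hsum (cell_parity c)) (reindex_inj (@perm_inj _ (cell_order c))) big_ord4.
have sE : antipode_sum (y \o cell_basis c) = s.
  rewrite /antipode_sum /cell_basis /=; case: (cell_star c) => /=; rewrite !yh -?/(l _).
    exact: (star_sum_identity (comring_theory A)).
  by rewrite addrC subrK.
have lE k : low_coord (y \o cell_basis c) k = l k.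
  rewrite /low_coord sE /cell_basis /=; case: (cell_star c) => /=.
    elim/ord4_ind: k => //=; by rewrite yh subKr.
  elim/ord4_ind: k => //=; rewrite !yh ?subKr -?/(l _) //.
  exact: (path_low_identity (comring_theory A)).
rewrite -[a]vertexK -(permKV (cell_order c) (diagonal a)) cube_of_basis_vertex lE sE.
by case: eqP => [->//|/eqP]; rewrite -yh; case: (parity a); case: (cell_parity c).
Qed.

End Reconstruction.

(** Only sums and differences occur. This covers ring homomorphisms and also the extraction of a
    coefficient. *)
Lemma cube_of_basis_raddf (A B : comNzRingType) (f : {additive A -> B}) c z a :
  f (cube_of_basis c z a) = cube_of_basis c (f \o z) a.
Proof.
have fS : f (antipode_sum c z) = antipode_sum c (f \o z).
  by rewrite /antipode_sum; case: (cell_star c); rewrite !(raddfB, raddfD).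
have fl k : f (low_coord c z k) = low_coord c (f \o z) k.
  rewrite /low_coord; case: (cell_star c); first by case: eqP; rewrite // raddfB fS.
  by elim/ord4_ind: k; rewrite /= ?(raddfB, raddfD) ?fS.
by rewrite /cube_of_basis; case: eqP; rewrite ?raddfB ?fS fl.
Qed.

End Cells.

Lemma rmorph_cube_eval (K : fieldType) (A B : comNzRingType) (iota : {rmorphism K -> A})
    (j : {rmorphism K -> B}) (f : {rmorphism A -> B}) y p :
  (forall c, f (iota c) = j c) -> f (cube_eval iota y p) = cube_eval j (f \o y) p.
Proof.
move=> fj; rewrite /cube_eval /mmap rmorph_sum /=; apply: eq_bigr => m _.
rewrite rmorphM fj; congr (_ * _)%R; rewrite /mmap1 rmorph_prod.
by apply: eq_bigr => i _; rewrite rmorphXn.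
Qed.

(** * Gauss valuations attached to cells *)

Section CellValuation.
Variables (R : realType) (K : fieldType) (v : K -> \bar R).
Hypothesis v_val : ring_valuation v.
Implicit Types (c : cell) (eta : cube -> R).

Local Notation P := (mpoly 4 K).

Definition generic_cube c : cube -> P := cube_of_basis c (fun k => mpolyX K (mnm1 k)).

(** Only the four entries of [eta] on the basis enter; the other coordinates may receive values
    different from [eta]. *)
Definition cell_val c eta : coord_ring K -> \bar R :=
  pullback (@mpolyC 4 K) (generic_cube c) (gauss v (eta \o cell_basis c)).

Lemma hyperdet_generic_cube c :
  cube_eval (@mpolyC 4 K) (generic_cube c) (hyperdet K) = 0%R.
Proof.
rewrite cube_eval_hyperdet.
have [hS hsum] := cube_of_basis_linear c (fun k => mpolyX K (mnm1 k)).
exact: paired_hyperdet_linear hS (hsum false).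
Qed.

Lemma cell_val_pi c eta p : cell_val c eta (\pi_(coord_ring K)%qT p) =
  gauss v (eta \o cell_basis c) (cube_eval (@mpolyC 4 K) (generic_cube c) p).
Proof. by rewrite /cell_val pullback_pi // hyperdet_generic_cube. Qed.

Lemma cell_val_Xan c eta : Xan v (cell_val c eta).
Proof.
apply: pullback_Xan; first exact: hyperdet_generic_cube.
  exact: gauss_val.
by move=> a; exact: gaussC.
Qed.

Lemma cell_val_coord c eta a : cell_val c eta (HyperdetAlgebra.coord K a) =
  gauss v (eta \o cell_basis c) (generic_cube c a).
Proof. by rewrite /cell_val pullback_coord // hyperdet_generic_cube. Qed.

(* A valuation is bounded below by the monomial valuation taking the same values on
   a basis; as every basis consists of cube coordinates, cells that give the
   coordinates the same values define the same valuation. *)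
Lemma cell_val_le c c' eta :
    (forall a, cell_val c eta (HyperdetAlgebra.coord K a) = (eta a)%:E) ->
  forall f, cell_val c' eta f <= cell_val c eta f.
Proof.
move=> hc f; rewrite -[f]reprK !cell_val_pi; move: (repr f) => p.
pose h k := generic_cube c (cell_basis c' k).
(* Change of basis: the generic point of [c] is reconstructed from its own entries on the basis of
   [c']. *)
have -> : cube_eval (@mpolyC 4 K) (generic_cube c) p =
    mmap (@mpolyC 4 K) h (cube_eval (@mpolyC 4 K) (generic_cube c') p).
  rewrite (rmorph_cube_eval _ (j := @mpolyC 4 K)); last by move=> x; exact: mmapC.
  rewrite /cube_eval; congr (mmap _ _ _); apply/funext => i /=.
  rewrite cube_of_basis_raddf -[LHS](cube_of_basisK c' (cube_of_basis_linear c _)).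
  by congr (cube_of_basis _ _ _); apply/funext => k /=; rewrite mmapX mmap1U.
apply: gauss_le_comp => //.
- exact: gauss_val.
- by move=> x; exact: gaussC.
- by move=> k; rewrite -hc cell_val_coord.
Qed.

End CellValuation.

(** * The slice and the candidate sections *)

Section Continuity.
Variables (R : realType) (X : topologicalType).

Lemma continuous_to_ptws (S : Type) (Y : topologicalType) (f : X -> {ptws S -> Y}) :
  (forall s, continuous (fun x => f x s)) -> continuous f.
Proof.
move=> h x; apply/cvg_sup => s.
by apply: (@continuous_comp_initial _ _ _ (@proj S (fun=> Y) s) f); exact: h.
Qed.

Lemma continuous_ptws_eval (S : eqType) (Y : topologicalType) (s : S) :
  continuous (fun f : {ptws S -> Y} => f s).
Proof. exact: (@proj_continuous S (fun=> Y) s). Qed.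

Lemma continuous_cst (Y : topologicalType) (y : Y) : continuous (fun _ : X => y).
Proof. by move=> x; exact: cvg_cst. Qed.

Lemma continuous_add (f g : X -> R) : continuous f -> continuous g ->
  continuous (fun x => f x + g x)%R.
Proof. by move=> cf cg x; apply: cvgD; [exact: cf|exact: cg]. Qed.

Lemma continuous_opp (f : X -> R) : continuous f -> continuous (fun x => - f x)%R.
Proof. by move=> cf x; apply: cvgN; exact: cf. Qed.

Lemma continuous_sub (f g : X -> R) : continuous f -> continuous g ->
  continuous (fun x => f x - g x)%R.
Proof. by move=> cf cg; apply: continuous_add => //; exact: continuous_opp. Qed.

Lemma continuous_mul (f g : X -> R) : continuous f -> continuous g ->
  continuous (fun x => f x * g x)%R.
Proof. by move=> cf cg x; apply: cvgM; [exact: cf|exact: cg]. Qed.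

Lemma continuous_sum (I : Type) (s : seq I) (P : pred I) (f : I -> X -> R) :
  (forall i, continuous (f i)) -> continuous (fun x => \sum_(i <- s | P i) f i x)%R.
Proof.
move=> cf; elim: s => [|i s IH].
  by under eq_fun do rewrite big_nil; exact: continuous_cst.
under eq_fun do rewrite big_cons; case: (P i) => //.
exact: continuous_add.
Qed.

Lemma continuous_mulrn (f : X -> R) n : continuous f -> continuous (fun x => f x *+ n)%R.
Proof.
move=> cf; elim: n => [|n IH]; first by under eq_fun do rewrite mulr0n; exact: continuous_cst.
by under eq_fun do rewrite mulrS; exact: continuous_add.
Qed.

Lemma continuous_bigmax d (Y : orderTopologicalType d) (I : Type) (s : seq I)
    (P : pred I) (x0 : X -> Y) (f : I -> X -> Y) : continuous x0 ->
    (forall i, continuous (f i)) ->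
  continuous (fun x => \big[Order.max/x0 x]_(i <- s | P i) f i x).
Proof.
move=> cx0 cf; elim: s => [|i s IH].
  by under eq_fun do rewrite big_nil.
under eq_fun do rewrite big_cons; case: (P i) => //.
by apply: max_fun_continuous.
Qed.

Lemma continuous_seqmin d (Y : orderTopologicalType d) (I : Type) (s : seq I)
    (x0 : Y) (f : I -> X -> Y) : (forall i, continuous (f i)) ->
  continuous (fun x => \big[Order.min/x0]_(i <- s) f i x).
Proof.
move=> cf; elim: s => [|i s IH].
  by under eq_fun do rewrite big_nil; exact: continuous_cst.
under eq_fun do rewrite big_cons.
by apply: min_fun_continuous.
Qed.

Lemma continuous_addEFin (f : X -> \bar R) (g : X -> R) : continuous f ->
  continuous g -> continuous (fun x => f x + (g x)%:E).
Proof.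
move=> cf cg x; apply: cvgeD; [exact: fin_num_adde_defl|exact: cf|].
by apply: cvg_EFin; [exact: nearW|exact: cg].
Qed.

Lemma continuous_row n (f : X -> 'I_n -> R) i :
  continuous (f^~ i) -> continuous (fun x => (\row_j f x j)%R 0%R i).
Proof. by move=> cf; under eq_fun do rewrite mxE; exact: cf. Qed.

End Continuity.

(** * Water-filling and the slice through the torus orbits *)

Section Slice.
Variable R : realType.
Local Open Scope ring_scope.
Implicit Types (xi : {ptws cube -> R}) (p : 'I_4 -> R) (q : R).

(* The solution [t] of [\sum_i max (p i - t) 0 = q] for [0 <= q]. *)
Definition water_level p q : R :=
  \big[Order.max/(\sum_i p i - q) / 4%:R]_(I : {set 'I_4} | I != finset.set0)
    ((\sum_(i in I) p i - q) / #|I|%:R).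

Definition excess p q i : R := Order.max (p i - water_level p q) 0.

(** Every nonempty [I] satisfies [\sum_(i in I) (p i - t) <= q], with equality where the maximum is
    attained. The set of [i] with [t < p i] gives one inequality; a maximising set gives the other,
    as [excess] dominates both [p i - t] and zero. *)
Lemma sum_excess p q : 0 <= q -> \sum_i excess p q i = q.
Proof.
move=> q0; set t := water_level p q.
have t_ge (I : {set 'I_4}) : I != finset.set0 -> \sum_(i in I) (p i - t) <= q.
  move=> I0; have : (\sum_(i in I) p i - q) / #|I|%:R <= t.
    by rewrite /t /water_level; apply: le_bigmax_cond.
  rewrite ler_pdivrMr; last by rewrite ltr0n card_gt0.
  by rewrite sumrB sumr_const -mulr_natr; lra.
have [I tE] : exists I : {set 'I_4}, \sum_(i in I) (p i - t) = q.
  have sE (I : {set 'I_4}) : I != finset.set0 ->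
      (\sum_(i in I) p i - q) / #|I|%:R = t -> \sum_(i in I) (p i - t) = q.
    move=> I0 /(congr1 (fun x => x * #|I|%:R)); rewrite mulfVK; last first.
      by rewrite pnatr_eq0 cards_eq0.
    by rewrite sumrB sumr_const -mulr_natr; lra.
  have T0 : [set: 'I_4]%SET != finset.set0 by apply/finset.set0Pn; exists o0; rewrite inE.
  (* The default value of the maximum is its term for the full set, so a nonempty set always attains
     it. *)
  have TE : (\sum_i p i - q) / 4%:R = (\sum_(i in [set: 'I_4]%SET) p i - q) / #|[set: 'I_4]%SET|%:R.
    by rewrite cardsT card_ord; congr ((_ - _) / _); apply: eq_bigl => i; rewrite inE.
  rewrite /t /water_level in sE *.
  elim/big_ind: (\big[_/_]_(_ | _) _) sE => [|x y IHx IHy|I I0] sE.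
  - by exists [set: 'I_4]%SET; apply: sE => //; rewrite TE.
  - by move: sE; rewrite /Order.max; case: ifP => _.
  - by exists I; apply: sE.
apply/eqP; rewrite eq_le; apply/andP; split.
  pose J := [set i | t < p i]%SET.
  have -> : \sum_i excess p q i = \sum_(i in J) (p i - t).
    rewrite [RHS]big_mkcond; apply: eq_bigr => i _; rewrite inE /excess -/t.
    by case: ltP => h; [rewrite max_l | rewrite max_r]; lra.
  have [->|] := eqVneq J finset.set0; first by rewrite big_set0.
  exact: t_ge.
rewrite -[X in X <= _]tE big_mkcond; apply: ler_sum => i _; rewrite /excess -/t.
by case: ifP => _; rewrite le_max lexx ?orbT.
Qed.

Definition mean_diagonal xi : R :=
  (\sum_i (xi (vertex i false) + xi (vertex i true))) / 4%:R.

(** Subtracting the mean removes the common amount by which the torus shifts all antipodal sums. *)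
Definition diagonal_sum xi i : R :=
  xi (vertex i false) + xi (vertex i true) - mean_diagonal xi.

Definition parity_gap xi : R :=
  \sum_i xi (vertex i false) - \sum_i xi (vertex i true).

(** One of the two excesses always vanishes, so a gap of either sign is covered by one continuous
    formula. *)
Definition shift xi i : R :=
  excess (diagonal_sum xi) (Order.max (parity_gap xi) 0) i
  - excess (diagonal_sum xi) (Order.max (- parity_gap xi) 0) i.

Definition slice xi (a : cube) : R :=
  (diagonal_sum xi (diagonal a)
   + (if parity a then - shift xi (diagonal a) else shift xi (diagonal a))) / 2%:R.

Lemma sum_shift xi : \sum_i shift xi i = parity_gap xi.
Proof.
rewrite /shift sumrB !sum_excess ?le_max ?lexx ?orbT //.
by case: (leP 0 (parity_gap xi)) => h; rewrite ?(max_l h) ?(max_r (ltW h));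
   [rewrite max_r | rewrite max_l]; lra.
Qed.

Lemma slice_diagonal xi i :
  slice xi (vertex i false) + slice xi (vertex i true) = diagonal_sum xi i.
Proof. by rewrite /slice !diagonal_vertex !parity_vertex; lra. Qed.

Lemma slice_gap xi :
  \sum_i slice xi (vertex i false) - \sum_i slice xi (vertex i true) = parity_gap xi.
Proof.
rewrite -sumrB -sum_shift; apply: eq_bigr => i _.
by rewrite /slice !diagonal_vertex !parity_vertex; lra.
Qed.

(** One of many solutions of the system in [pairing_slice_torus], normalised by zero first entries
    in the second and third factors. *)
Definition slice_torus xi : triple R :=
  let z a := xi a - slice xi a in
  (\row_i (if i == 0 then z (0, 0, 0) else z (1, 0, 0)),
   \row_j (if j == 0 then 0 else z (0, 1, 0) - z (0, 0, 0)),
   \row_k (if k == 0 then 0 else z (0, 0, 1) - z (0, 0, 0))).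

(** In [xi - slice xi] the antipodal sums are all equal and the parity gap is zero. These equations
    cut out the directions of the torus orbits. *)
Lemma pairing_slice_torus xi a :
  pairing (xweight a) (slice_torus xi) = xi a - slice xi a.
Proof.
have := slice_gap xi; rewrite /parity_gap.
have := slice_diagonal xi o0; have := slice_diagonal xi o1.
have := slice_diagonal xi o2; have := slice_diagonal xi o3.
rewrite /diagonal_sum /mean_diagonal !big_ord4 /vertex /= => h0 h1 h2 h3 hg.
rewrite pairing_xweight; case: a => [[i j] k]; rewrite /= !mxE.
by case: (I2P i) => ->; case: (I2P j) => ->; case: (I2P k) => -> /=; lra.
Qed.

(** The torus moves all antipodal sums by one amount and both parity sums by another. *)
Lemma slice_trop_act tau xi : slice (trop_act tau xi) = slice xi.
Proof.
have E0 : diagonal_sum (trop_act tau xi) = diagonal_sum xi.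
  apply/funext => i; rewrite /diagonal_sum /mean_diagonal !big_ord4.
  by elim/ord4_ind: i; rewrite /trop_act /vertex /=; lra.
have E1 : parity_gap (trop_act tau xi) = parity_gap xi.
  by rewrite /parity_gap !big_ord4 /trop_act /vertex /=; lra.
by apply/funext => a; rewrite /slice /shift E0 E1.
Qed.

Let continuous_diagonal_sum i : continuous (fun xi => diagonal_sum xi i).
Proof.
have c2 j : continuous (fun xi => xi (vertex j false) + xi (vertex j true)).
  by apply: continuous_add; exact: continuous_ptws_eval.
apply: continuous_sub => //; apply: continuous_mul; last exact: continuous_cst.
exact: continuous_sum.
Qed.

Let continuous_excess (q : {ptws cube -> R} -> R) i : continuous q ->
  continuous (fun xi => excess (diagonal_sum xi) (q xi) i).
Proof.
move=> cq; apply: max_fun_continuous; last exact: continuous_cst.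
apply: continuous_sub => //; apply: continuous_bigmax => [|I].
- apply: continuous_mul; last exact: continuous_cst.
  by apply: continuous_sub => //; exact: continuous_sum.
- apply: continuous_mul; last exact: continuous_cst.
  by apply: continuous_sub => //; exact: continuous_sum.
Qed.

Lemma continuous_slice a : continuous (fun xi => slice xi a).
Proof.
have cg : continuous parity_gap.
  by apply: continuous_sub; apply: continuous_sum => i; exact: continuous_ptws_eval.
have cs : continuous (fun xi => shift xi (diagonal a)).
  apply: continuous_sub; apply: continuous_excess;
    apply: max_fun_continuous; by [exact: continuous_cst | exact: continuous_opp | ].
apply: continuous_mul; last exact: continuous_cst.
by apply: continuous_add => //; case: (parity a) => //; exact: continuous_opp.
Qed.

Lemma continuous_pairing_slice_torus b :
  continuous (fun xi => pairing b (slice_torus xi)).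
Proof.
have cz a : continuous (fun xi : {ptws cube -> R} => xi a - slice xi a).
  by apply: continuous_sub; [exact: continuous_ptws_eval | exact: continuous_slice].
apply: continuous_sum => i.
repeat apply: continuous_add; apply: continuous_mul; try exact: continuous_cst.
all: apply: continuous_row; case: (i == 0) => //; try exact: continuous_cst.
all: exact: continuous_sub.
Qed.

End Slice.

(** * The candidate of each cell, and their maximum *)

Section SectionCandidates.
Variables (R : realType) (K : fieldType) (v : K -> \bar R).
Hypothesis v_val : ring_valuation v.

Definition cell_section (c : cell) (xi : {ptws cube -> R}) : {ptws coord_ring K -> \bar R} :=
  mu (slice_torus xi) (cell_val v c (slice xi)).

(** For fixed [f] the weights and supports are fixed, leaving nested finite minima of constants plus
    continuous real functions. *)
Lemma continuous_cell_section c f : continuous (fun xi => cell_section c xi f).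
Proof.
have -> : (fun xi => cell_section c xi f) = (fun xi =>
    \big[mine/+oo]_(b <- weights f) (cell_val v c (slice xi) (weight_component b f)
       + (pairing b (slice_torus xi))%:E)).
  apply/funext => xi; rewrite /cell_section mu_seqmin //.
  by have [/val0] := cell_val_Xan v_val c (slice xi).
apply: continuous_seqmin => b; apply: continuous_addEFin; last exact: continuous_pairing_slice_torus.
apply: continuous_seqmin => m; apply: continuous_addEFin; first exact: continuous_cst.
apply: continuous_sum => k; apply: continuous_mulrn; exact: continuous_slice.
Qed.

Lemma cell_section_trop_act c tau xi :
  cell_section c (trop_act tau xi) = mu tau (cell_section c xi).
Proof.
have w0 : cell_val v c (slice xi) 0%R = +oo.
  by have [/val0] := cell_val_Xan v_val c (slice xi).
rewrite /cell_section mu_mu // slice_trop_act; apply: eq_mu => // a.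
by rewrite pairingDr !pairing_slice_torus slice_trop_act trop_actE addrA.
Qed.

Lemma cell_section_Zan c xi : Zan v (cell_section c xi).
Proof.
exists (slice_torus xi, cell_val v c (slice xi)) => //.
by split => //; exact: cell_val_Xan.
Qed.

(** The conditions at the four basis vertices hold by construction; the content lies in the other
    four. *)
Definition valid_cell c (xi : {ptws cube -> R}) : Prop :=
  forall a, cell_val v c (slice xi) (HyperdetAlgebra.coord K a) = (slice xi a)%:E.

Lemma valid_cell_trop c xi : valid_cell c xi -> trop (cell_section c xi) = EFin \o xi.
Proof.
move=> hc; apply/funext => a; rewrite /trop /cell_section mu_coord; last first.
  by have [/val0] := cell_val_Xan v_val c (slice xi).
by rewrite hc pairing_slice_torus -EFinD addrC subrK.
Qed.

(** By minimality of Gauss valuations no candidate exceeds that of a valid cell, so the choice of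
    valid cell is immaterial. *)
Lemma valid_cell_max c xi : valid_cell c xi ->
  forall f, \big[maxe/-oo]_(c' : cell) cell_section c' xi f = cell_section c xi f.
Proof.
move=> hc f; apply/eqP; rewrite eq_le; apply/andP; split.
  apply/bigmax_leP; split=> [|c' _]; first exact: leNye.
  by apply: le_mu; exact: cell_val_le.
exact: (le_bigmax_cond _ (fun c' => cell_section c' xi f)).
Qed.

Lemma section_of_valid_cells :
    (forall xi, TropX0 v xi -> exists c, valid_cell c xi) ->
  exists sigma : {ptws cube -> R} -> {ptws coord_ring K -> \bar R},
    [/\ {within TropX0 v, continuous sigma},
        forall xi, TropX0 v xi -> Zan0 v (sigma xi),
        forall xi, TropX0 v xi -> trop (sigma xi) = EFin \o xi
      & forall tau xi, TropX0 v xi ->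
          sigma (trop_act tau xi) = mu tau (sigma xi)].
Proof.
move=> valid.
pose sigma (xi : {ptws cube -> R}) : {ptws coord_ring K -> \bar R} :=
  fun f => \big[maxe/-oo]_(c : cell) cell_section c xi f.
have sigmaE xi c : valid_cell c xi -> sigma xi = cell_section c xi.
  by move=> hc; apply/funext => f; exact: valid_cell_max.
exists sigma; split.
(* The maximum is continuous on the whole space; validity concerns only its values. *)
- apply: continuous_subspaceT; apply: continuous_to_ptws => f.
  apply: continuous_bigmax => [|c]; first exact: continuous_cst.
  exact: continuous_cell_section.
- move=> xi /valid[c hc]; rewrite (sigmaE _ _ hc); split; first exact: cell_section_Zan.
  by move=> a; rewrite valid_cell_trop.
- by move=> xi /valid[c hc]; rewrite (sigmaE _ _ hc); exact: valid_cell_trop.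
- move=> tau xi /valid[c hc]; rewrite (sigmaE _ _ hc) -cell_section_trop_act.
  (* Validity depends on the slice alone, so [c] remains valid along the orbit. *)
  by apply: sigmaE => a; rewrite slice_trop_act; exact: hc.
Qed.

End SectionCandidates.

(** * The tropical hyperdeterminant *)

Section TropicalHyperdeterminant.
Variables (R : realType) (A : comNzRingType) (w : A -> \bar R).
Hypothesis w_val : ring_valuation w.
Variables (y : cube -> A) (x : cube -> R).
Hypothesis wy : forall a, w (y a) = (x a)%:E.
Hypothesis hyperdet_y : paired_hyperdet y = 0%R.

Let P i : R := (x (vertex i false) + x (vertex i true))%R.
Let Q e : R := (\sum_i x (vertex i e))%R.

Let w_diag i : w (diag_prod y i) = (P i)%:E.
Proof. by rewrite /diag_prod (valM w_val) !wy. Qed.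

Let w_parity e : w (\prod_i y (vertex i e)) = (Q e)%:E.
Proof. by rewrite (val_prod w_val) -sumEFin; apply: eq_bigr => i _; rewrite wy. Qed.

Let w4 e : w (2%:R * 2%:R * \prod_i y (vertex i e))%R = w 2%:R%R + w 2%:R%R + (Q e)%:E.
Proof. by rewrite !(valM w_val) w_parity. Qed.

(** The square of the [i]-th diagonal product has coefficient one, and the other terms without a
    factor four have larger value. Only a parity product can then cancel it. *)
Lemma hyperdet_unique_min_diagonal i :
    (forall j, j != i -> (P i < P j)%R) ->
  exists e, w 2%:R%R + w 2%:R%R + (Q e)%:E <= (P i + P i)%:E.
Proof.
move=> Pi; apply: contrapT => /forallNP hQ.
have Q4 e : (P i + P i)%:E < w (2%:R * 2%:R * \prod_i y (vertex i e))%R.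
  by rewrite w4 ltNge; apply/negP; exact: hQ.
pose T := (\sum_(j | j != i) diag_prod y j)%R.
have wT : (P i)%:E < w T.
  by apply: (val_gt_sum w_val) => j /Pi; rewrite w_diag lte_fin.
have sq2 : (P i + P i)%:E < w (2%:R * \sum_(j | j != i) diag_prod y j * diag_prod y j)%R.
  rewrite mulr_sumr; apply: (val_gt_sum w_val) => j /Pi Pij.
  rewrite (valM w_val) (valM w_val (diag_prod y j)) w_diag; apply: (@lt_le_trans _ _ (P j + P j)%:E).
    by rewrite lte_fin; lra.
  by rewrite EFinD leeDr // (val_natr w_val).
have pT : (P i + P i)%:E < w (diag_prod y i * T)%R.
  by rewrite (valM w_val) w_diag EFinD lteD2lE //; exact: wT.
have TT : (P i + P i)%:E < w (T * T)%R.
  by rewrite (valM w_val) EFinD; apply: lteD.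
suff : (P i + P i)%:E < w (diag_prod y i * diag_prod y i)%R.
  by rewrite (valM w_val) !w_diag ltxx.
have -> : (diag_prod y i * diag_prod y i =
    diag_prod y i * T + diag_prod y i * T + T * T
    - 2%:R * (\sum_(j | j != i) diag_prod y j * diag_prod y j)
    - (2%:R * 2%:R * \prod_i y (vertex i false)
       + 2%:R * 2%:R * \prod_i y (vertex i true)))%R.
  have SE : (\sum_j diag_prod y j = diag_prod y i + T)%R by rewrite (bigD1 i).
  have S2E : (\sum_j diag_prod y j * diag_prod y j = diag_prod y i * diag_prod y i
      + \sum_(j | j != i) diag_prod y j * diag_prod y j)%R by rewrite (bigD1 i).
  apply/eqP; rewrite -subr_eq0; apply/eqP; rewrite -[RHS]hyperdet_y.
  rewrite /paired_hyperdet /= SE S2E mulr2n.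
  exact: (isolate_identity (comring_theory A)).
do 2?[apply: (val_gtB w_val) => //]; repeat apply: (val_gtD w_val) => //.
Qed.

(** Otherwise four times the product over parity [e] would be the only term of least value. *)
Lemma hyperdet_unique_min_parity (e : bool) (m : R) : (forall i, m <= P i)%R ->
    (Q e < Q (~~ e))%R -> (m + m)%:E <= w 2%:R%R + w 2%:R%R + (Q e)%:E.
Proof.
move=> mP Qe; rewrite leNgt; apply/negP => hQ.
(* The assumed strict bound excludes the value [+oo], hence also characteristic two, so [w 2] can be
   cancelled when the two parities are compared. *)
have w2 : w 2%:R%R + w 2%:R%R \is a fin_num.
  by case: (w 2%:R%R) (valNy w_val 2%:R%R) hQ.
pose S := (\sum_i diag_prod y i)%R.
have SS : (m + m)%:E <= w (S * S)%R.
  rewrite (valM w_val) EFinD; apply: leeD; apply: (val_ge_sum w_val) => i _;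
    by rewrite w_diag lee_fin.
have sq2 : (m + m)%:E <= w (2%:R * \sum_i diag_prod y i * diag_prod y i)%R.
  rewrite mulr_sumr; apply: (val_ge_sum w_val) => i _.
  rewrite (valM w_val) (valM w_val (diag_prod y i)) w_diag.
  apply: (@le_trans _ _ (P i + P i)%:E); first by rewrite lee_fin lerD.
  by rewrite EFinD leeDr // (val_natr w_val).
suff : w (2%:R * 2%:R * \prod_i y (vertex i e))%R <
       w (2%:R * 2%:R * \prod_i y (vertex i e))%R by rewrite ltxx.
rewrite {1}w4.
have -> : (2%:R * 2%:R * \prod_i y (vertex i e) =
    S * S - 2%:R * (\sum_i diag_prod y i * diag_prod y i)
    - 2%:R * 2%:R * \prod_i y (vertex i (~~ e)))%R.
  apply/eqP; rewrite -subr_eq0; apply/eqP; rewrite -[RHS]hyperdet_y.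
  rewrite /paired_hyperdet -/S /= mulr2n.
  by case: (e); [rewrite [in RHS](addrC (\prod_i y (vertex i false))%R) |];
     exact: (isolate_parity_identity (comring_theory A)).
have lt_e z : (m + m)%:E <= z -> w 2%:R%R + w 2%:R%R + (Q e)%:E < z.
  exact: lt_le_trans.
apply: (val_gtB w_val); first by apply: (val_gtB w_val); exact: lt_e.
by rewrite w4 lteD2lE // lte_fin.
Qed.

End TropicalHyperdeterminant.

(** * When a cell gives all eight coordinates their prescribed values *)

Section CellCriteria.
Variables (R : realType) (K : fieldType) (v : K -> \bar R).
Hypothesis v_val : ring_valuation v.

Lemma mnm_pairing1 n (eta : 'I_n -> R) k : mnm_pairing eta (mnm1 k) = eta k.
Proof.
rewrite /mnm_pairing (bigD1 k) //= mnm1E eqxx big1 ?addr0 // => i ik.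
by rewrite mnm1E eq_sym (negbTE ik).
Qed.

Lemma gaussX n (eta : 'I_n -> R) k : gauss v eta (mpolyX K (mnm1 k)) = (eta k)%:E.
Proof.
apply/eqP; rewrite eq_le; apply/andP; split.
  apply: (le_trans (gauss_le v_val eta _ (mnm1 k))).
  by rewrite /gauss_term mcoeffX eqxx (val1 v_val) add0e mnm_pairing1.
apply/le_gaussP => // m; rewrite /gauss_term mcoeffX.
case: eqP => [<-|_]; first by rewrite (val1 v_val) add0e mnm_pairing1.
by rewrite (val0 v_val) addye ?leey.
Qed.

(** The coefficient at the [k]-th variable is reconstructed from the [k]-th unit vector. This
    supplies the upper bounds below; the lower bounds are ultrametric. *)
Lemma gauss_generic_cube_le c eta a k :
  gauss v (eta \o cell_basis c) (generic_cube K c a) <=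
  v (cube_of_basis c (fun j => (j == k)%:R%R) a) + (eta (cell_basis c k))%:E.
Proof.
apply: (le_trans (gauss_le v_val _ _ (mnm1 k))).
rewrite /gauss_term mnm_pairing1 /generic_cube cube_of_basis_raddf.
rewrite (_ : mcoeff _ \o _ = fun j => (j == k)%:R%R) //.
apply/funext => j /=; rewrite mcoeffX; have [->|jk] := eqVneq j k; first by rewrite eqxx.
by case: eqP => // /(congr1 (fun m : multinom 4 => m k)) /eqP; rewrite !mnm1E eqxx (negbTE jk).
Qed.

Variables (s : {perm 'I_4}) (e : bool) (eta : cube -> R).
Let low k := eta (vertex (s k) e).
Let high k := eta (vertex (s k) (~~ e)).

(** The missing lower entries contain [z o0], of least value, with coefficient of value zero. The
    missing upper entry is [z o1 + z o2 + z o3 - 2 z o0]; [tie] says that its value is attained by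
    [z o1] or by [2 z o0]. *)
Lemma star_cell_valid : (forall k, low k = low o0) -> (forall k, high o0 <= high k)%R ->
    (low o0 <= high o0)%R -> (high o0 - low o0)%:E <= v 2%:R%R ->
    high o1 = high o0 \/ v 2%:R%R = (high o0 - low o0)%:E ->
  forall a, cell_val v (s, e, true) eta (HyperdetAlgebra.coord K a) = (eta a)%:E.
Proof.
move=> lowE highE low_high v2 tie a; rewrite cell_val_coord //.
pose c : cell := (s, e, true).
have gv := gauss_val v_val (eta \o cell_basis c).
have ub b k := gauss_generic_cube_le c eta b k.
have gz k : gauss v (eta \o cell_basis c) (mpolyX K (mnm1 k)) =
    (if k == o0 then low k else high k)%:E.
  by rewrite gaussX /= /cell_basis /=; case: (k == o0).
have gz_ge k : (low o0)%:E <= gauss v (eta \o cell_basis c) (mpolyX K (mnm1 k)).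
  rewrite gz lee_fin; case: ifP => _; first by rewrite lowE.
  exact: le_trans (highE k).
rewrite -[a]vertexK -(permKV s (diagonal a)); move: (s^-1%g _) (parity a) => k e' {a}.
have [->|e'e] := eqVneq e' e; last (have {e'e} -> : e' = ~~ e by case: (e) e'e; case: e').
- rewrite -/(low k) lowE; apply/eqP; rewrite eq_le; apply/andP; split.
    apply: (le_trans (ub _ o0)); rewrite (cube_of_basis_vertex c) eqxx /=.
    rewrite /low_coord /antipode_sum /=.
    by elim/ord4_ind: k; rewrite /= ?(mulr1n, mulr0n, addr0, add0r, subr0, sub0r, opprK) ?(valN v_val) ?(val1 v_val) ?add0e.
  rewrite /generic_cube (cube_of_basis_vertex c) eqxx /low_coord /antipode_sum /=.
  case: ifP => _ //; apply: (val_geB gv) => //.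
  by apply: (val_geB gv) => //; apply: (val_geD gv) => //; apply: (val_geD gv).
- have ne : (~~ e == e) = false by case: (e).
  have [->|k0] := eqVneq k o0; last first.
    rewrite /generic_cube (cube_of_basis_vertex c) ne /low_coord /= (negbTE k0).
    by rewrite subKr gz (negbTE k0).
  apply/eqP; rewrite eq_le; apply/andP; split.
    case: tie => [tie|tie].
      apply: (le_trans (ub _ o1)); rewrite (cube_of_basis_vertex c) ne.
      by rewrite /low_coord /antipode_sum /= ?(mulr1n, mulr0n, addr0, add0r, subr0, sub0r, opprK) ?(valN v_val) ?(val1 v_val) add0e lee_fin -/(high o1) tie.
    apply: (le_trans (ub _ o0)); rewrite (cube_of_basis_vertex c) ne.
    rewrite /low_coord /antipode_sum /= ?(mulr1n, mulr0n, addr0, add0r, subr0, sub0r, opprK) ?(valN v_val) ?(val1 v_val) -opprD -mulr2n (valN v_val) tie.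
    by rewrite -EFinD lee_fin -/(low o0) -/(high o0); lra.
  rewrite /generic_cube (cube_of_basis_vertex c) ne /low_coord /antipode_sum /=.
  rewrite -addrA -opprD -mulr2n -mulr_natl; apply: (val_geB gv).
    by apply: (val_geD gv); [apply: (val_geD gv)|]; rewrite gz lee_fin highE.
  rewrite (valM gv) gz /= -[2%:R%R]/(1 *+ 2)%R -(mpolyC1 4 K) -mpolyCMn gaussC //.
  by rewrite -leeBlDr // -EFinB.
Qed.

(** Three missing entries contain [z o0], of least value, up to sign. The fourth is
    [z o2 + z o3 - z o1], and [tie] tells which term attains its value. *)
Lemma path_cell_valid : low o0 = high o0 -> low o1 = low o0 -> high o1 = low o0 ->
    (low o0 <= low o2)%R -> (low o2 <= low o3)%R -> (low o2 <= high o2)%R ->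
    (low o3 <= high o3)%R -> high o2 = low o2 \/ low o3 = low o2 ->
  forall a, cell_val v (s, e, false) eta (HyperdetAlgebra.coord K a) = (eta a)%:E.
Proof.
move=> h0 l1 h1 l02 l23 lh2 lh3 tie a; rewrite cell_val_coord //.
pose c : cell := (s, e, false).
have gv := gauss_val v_val (eta \o cell_basis c).
have ub b k := gauss_generic_cube_le c eta b k.
pose g k := gauss v (eta \o cell_basis c) (mpolyX K (mnm1 k)).
have gz0 : g o0 = (low o0)%:E by rewrite /g gaussX.
have gz1 : g o1 = (high o2)%:E by rewrite /g gaussX.
have gz2 : g o2 = (low o3)%:E by rewrite /g gaussX.
have gz3 : g o3 = (high o3)%:E by rewrite /g gaussX.
have gz_ge k : (low o0)%:E <= g k.
  by elim/ord4_ind: k; rewrite ?gz0 ?gz1 ?gz2 ?gz3 lee_fin; lra.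
have gz_ge2 k : k != o0 -> (low o2)%:E <= g k.
  by elim/ord4_ind: k => //; rewrite ?gz1 ?gz2 ?gz3 lee_fin; lra.
rewrite -[a]vertexK -(permKV s (diagonal a)); move: (s^-1%g _) (parity a) => k e' {a}.
have [->|e'e] := eqVneq e' e; last (have {e'e} -> : e' = ~~ e by case: (e) e'e; case: e').
- elim/ord4_ind: k.
  + by rewrite /generic_cube (cube_of_basis_vertex c) eqxx /low_coord /= -/(g _) gz0.
  + rewrite -/(low o1) l1; apply/eqP; rewrite eq_le; apply/andP; split.
      apply: (le_trans (ub _ o0)); rewrite (cube_of_basis_vertex c) eqxx /=.
      by rewrite /low_coord /antipode_sum /= ?(mulr1n, mulr0n, addr0, add0r, subr0, sub0r, opprK) ?(valN v_val) ?(val1 v_val) ?add0e.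
    rewrite /generic_cube (cube_of_basis_vertex c) eqxx /low_coord /antipode_sum /=.
    by apply: (val_geD gv); [apply: (val_geB gv)|]; exact: gz_ge.
  + apply/eqP; rewrite eq_le; apply/andP; split.
      case: tie => tie.
        apply: (le_trans (ub _ o1)); rewrite (cube_of_basis_vertex c) eqxx /=.
        by rewrite /low_coord /antipode_sum /= ?(mulr1n, mulr0n, addr0, add0r, subr0, sub0r, opprK) ?(valN v_val) ?(val1 v_val) ?add0e lee_fin -/(high o2) tie.
      apply: (le_trans (ub _ o2)); rewrite (cube_of_basis_vertex c) eqxx /=.
      by rewrite /low_coord /antipode_sum /= ?(mulr1n, mulr0n, addr0, add0r, subr0, sub0r, opprK) ?(valN v_val) ?(val1 v_val) ?add0e lee_fin -/(low o3) tie.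
    rewrite /generic_cube (cube_of_basis_vertex c) eqxx /low_coord /antipode_sum /=.
    by apply: (val_geB gv); [apply: (val_geD gv)|]; exact: gz_ge2.
  + by rewrite /generic_cube (cube_of_basis_vertex c) eqxx /low_coord /= -/(g _) gz2.
- have ne : (~~ e == e) = false by case: (e).
  elim/ord4_ind: k.
  + rewrite -/(high o0) -h0; apply/eqP; rewrite eq_le; apply/andP; split.
      apply: (le_trans (ub _ o0)); rewrite (cube_of_basis_vertex c) ne /=.
      by rewrite /low_coord /antipode_sum /= ?(mulr1n, mulr0n, addr0, add0r, subr0, sub0r, opprK) ?(valN v_val) ?(val1 v_val) ?add0e.
    rewrite /generic_cube (cube_of_basis_vertex c) ne /low_coord /antipode_sum /=.
    by apply: (val_geB gv); [apply: (val_geD gv)|]; exact: gz_ge.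
  + rewrite -/(high o1) h1; apply/eqP; rewrite eq_le; apply/andP; split.
      apply: (le_trans (ub _ o0)); rewrite (cube_of_basis_vertex c) ne /=.
      by rewrite /low_coord /antipode_sum /= ?(mulr1n, mulr0n, addr0, add0r, subr0, sub0r, opprK) ?(valN v_val) ?(val1 v_val) ?add0e.
    rewrite /generic_cube (cube_of_basis_vertex c) ne /low_coord /antipode_sum /=.
    apply: (val_geB gv); first by apply: (val_geD gv); exact: gz_ge.
    by apply: (val_geD gv); [apply: (val_geB gv)|]; exact: gz_ge.
  + rewrite /generic_cube (cube_of_basis_vertex c) ne /low_coord /= subKr.
    by rewrite -/(g _) gz1.
  + rewrite /generic_cube (cube_of_basis_vertex c) ne /low_coord /antipode_sum /=.
    by rewrite addrAC subrr add0r -/(g _) gz3.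
Qed.

End CellCriteria.

(** * Sorted diagonals, and the slice in terms of excesses *)

Section ValidCell.
Local Open Scope ring_scope.

Lemma sorting_perm d (T : orderType d) (f : 'I_4 -> T) : exists s : {perm 'I_4},
  [/\ f (s o0) <= f (s o1), f (s o1) <= f (s o2) & f (s o2) <= f (s o3)]%O.
Proof.
have /tuple_permP[s sE] : perm_eq (sort_tuple <=%O [tuple f i | i < 4]) [tuple f i | i < 4].
  by rewrite perm_sort.
have := sort_le_sorted [tuple f i | i < 4]; rewrite sE.
rewrite /= !enum_ordSl enum_ord0 /= !tnth_mktuple.
have -> : lift ord0 ord0 = o1 :> 'I_4 by apply: val_inj.
have -> : lift ord0 (lift ord0 ord0) = o2 :> 'I_4 by apply: val_inj.
have -> : lift ord0 (lift ord0 (lift ord0 ord0)) = o3 :> 'I_4 by apply: val_inj.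
by have -> : ord0 = o0 :> 'I_4 by [apply: val_inj]; case/and4P=> *; exists s.
Qed.

Variable R : realType.
Implicit Types (xi : {ptws cube -> R}) (p : 'I_4 -> R).

Lemma excess_ge0 p q i : 0 <= excess p q i.
Proof. by rewrite le_max lexx orbT. Qed.

Lemma excess_ge p q i : p i - water_level p q <= excess p q i.
Proof. by rewrite le_max lexx. Qed.

Lemma excessE p q i : excess p q i = 0 \/ excess p q i = p i - water_level p q.
Proof. by rewrite /excess /Order.max; case: ifP => _; [left|right]. Qed.

Lemma excess0 p i : excess p 0 i = 0.
Proof.
have /psumr_eq0P E : \sum_i excess p 0 i = 0 by rewrite sum_excess.
by apply: E => // j _; exact: excess_ge0.
Qed.

(** Both signs of the gap are treated at once: [e] is a parity of smallest sum, and its vertices are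
    the lowered ones. *)
Lemma slice_excess xi i : let e := 0 <= parity_gap xi in
  let d := excess (diagonal_sum xi) `|parity_gap xi| i in
  slice xi (vertex i e) = (diagonal_sum xi i - d) / 2%:R /\
  slice xi (vertex i (~~ e)) = (diagonal_sum xi i + d) / 2%:R.
Proof.
rewrite /slice /shift !diagonal_vertex !parity_vertex.
case: (leP 0 (parity_gap xi)) => h /=.
  have h' : - parity_gap xi <= 0 by lra.
  by rewrite (max_r h') excess0 subr0 ger0_norm.
have h' : 0 <= - parity_gap xi by lra.
by rewrite (max_l h') excess0 sub0r opprK ltr0_norm.
Qed.

End ValidCell.

(** * Every point of [TropX0] has a valid cell *)

Section Existence.
Variables (R : realType) (K : fieldType) (v : K -> \bar R).
Hypothesis v_val : ring_valuation v.

Lemma paired_hyperdet_coord :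
  paired_hyperdet (HyperdetAlgebra.coord K) = 0%R :> coord_ring K.
Proof.
have : \pi_(coord_ring K)%qT (hyperdet K) = 0%R.
  rewrite -(rmorph0 (\pi_(coord_ring K)%qT)); apply/eq_pi/asboolP.
  by exists 1%R; rewrite mul1r subr0.
rewrite hyperdet_paired /paired_hyperdet /diag_prod /= !big_ord4 /=.
by rewrite !(rmorphD, rmorphN, rmorphM, rmorph1, rmorphMn).
Qed.

Lemma Xan_natr w n : Xan v w -> w n%:R%R = v n%:R%R.
Proof.
move=> [_ <-]; congr w.
by rewrite /HyperdetAlgebra.scalar mpolyCMn mpolyC1 rmorphMn rmorph1.
Qed.

(** If the water level is at most every diagonal sum, all lower vertices have equal height and a
    star works. Otherwise the lowest diagonal is untouched and a path works. The required ties come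
    from the tropical hyperdeterminant. *)
Lemma valid_cell_exists xi : TropX0 v xi -> exists c, valid_cell v c xi.
Proof.
move=> [w wX trop_w]; have [w_val _] := wX.
have wy a : w (HyperdetAlgebra.coord K a) = (xi a)%:E by rewrite -[RHS]/((EFin \o xi) a) -trop_w.
pose P i := (xi (vertex i false) + xi (vertex i true))%R.
pose Q e := (\sum_i xi (vertex i e))%R.
have tropA i : (forall j, j != i -> (P i < P j)%R) ->
    exists e, v 2%:R%R + v 2%:R%R + (Q e)%:E <= (P i + P i)%:E.
  by rewrite -(Xan_natr 2 wX); exact: (hyperdet_unique_min_diagonal w_val wy paired_hyperdet_coord).
have tropB e m : (forall i, m <= P i)%R -> (Q e < Q (~~ e))%R ->
    (m + m)%:E <= v 2%:R%R + v 2%:R%R + (Q e)%:E.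
  by rewrite -(Xan_natr 2 wX); exact: (hyperdet_unique_min_parity w_val wy paired_hyperdet_coord).
have v2_ge0 := val_natr v_val 2.
set mu := mean_diagonal xi.
pose p := diagonal_sum xi; pose e := (0 <= parity_gap xi)%R.
pose g := `|parity_gap xi|%R; pose t := water_level p g.
have [s [p01 p12 p23]] := sorting_perm p.
have pE i : P i = (p i + mu)%R by rewrite /p /diagonal_sum /P subrK.
have g_gap : (g = Q (~~ e) - Q e)%R.
  by rewrite /g /e; case: (ger0P (parity_gap xi)) => _ //=; rewrite opprB.
pose d k := excess p g (s k).
have dE k : d k = 0%R \/ d k = (p (s k) - t)%R by exact: excessE.
have d0 k : (0 <= d k)%R by exact: excess_ge0.
have dt k : (p (s k) - t <= d k)%R by exact: excess_ge.
have lowE k : slice xi (vertex (s k) e) = ((p (s k) - d k) / 2%:R)%R.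
  by have [] := slice_excess xi (s k).
have highE k : slice xi (vertex (s k) (~~ e)) = ((p (s k) + d k) / 2%:R)%R.
  by have [] := slice_excess xi (s k).
have d_sum : (d o0 + d o1 + d o2 + d o3 = g)%R.
  have := sum_excess p (normr_ge0 (parity_gap xi)).
  by rewrite (reindex_inj (@perm_inj _ s)) big_ord4.
have p_sum : (p (s o0) + p (s o1) + p (s o2) + p (s o3) + mu * 4%:R = Q e + Q (~~ e))%R.
  have -> : (Q e + Q (~~ e) = \sum_i P i)%R.
    by rewrite big_split /= -/(Q false) -/(Q true); case: (e) => //=; rewrite addrC.
  by rewrite (reindex_inj (@perm_inj _ s)) big_ord4 /= !pE; lra.
have sorted0 k : (p (s o0) <= p (s k))%R by elim/ord4_ind: k; lra.
(* [tropA] yields some parity; the bound passes to [e], whose sum is smallest. *)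
have tie_p : (p (s o0) < p (s o1))%R ->
    v 2%:R%R + v 2%:R%R + (Q e)%:E <= (P (s o0) + P (s o0))%:E.
  move=> p0_lt.
  have [j|e' he'] := tropA (s o0).
    rewrite -(permKV s j) (inj_eq perm_inj) !pE ltrD2r.
    by elim/ord4_ind: (s^-1%g j) => // _; lra.
  apply: le_trans he'; apply: leeD2l; rewrite lee_fin.
  have := normr_ge0 (parity_gap xi); rewrite -/g g_gap.
  by case: (e) e' => -[] /=; lra.
have [tp|pt] := leP t (p (s o0)).
- have dE' k : d k = (p (s k) - t)%R.
    by have := sorted0 k; case: (dE k) (dt k) => -> //; lra.
  have QeE : (Q e = t * 2%:R + mu * 2%:R)%R by move: d_sum; rewrite !dE'; lra.
  (* With a positive gap this is [tropB] for the least antipodal sum; with zero gap all excesses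
     vanish. *)
  have v2_ge : (p (s o0) - t)%:E <= v 2%:R%R.
    have [Q_lt|Q_ge] := ltP (Q e) (Q (~~ e)); last first.
      suff -> : (p (s o0) - t = 0)%R by [].
      by rewrite -dE'; have := d0 o0; have := d0 o1; have := d0 o2; have := d0 o3; lra.
    have P_ge i : (p (s o0) + mu <= P i)%R by rewrite pE lerD2r -(permKV s i); exact: sorted0.
    have := tropB e _ P_ge Q_lt; rewrite QeE.
    case: (v 2%:R%R) v2_ge0 => [r _| |]; rewrite ?leey ?leeNy_eq //.
    by rewrite -!EFinD !lee_fin; lra.
  have heightE : (slice xi (vertex (s o0) (~~ e)) - slice xi (vertex (s o0) e) = p (s o0) - t)%R.
    by rewrite lowE highE dE'; lra.
  exists (s, e, true); apply: star_cell_valid => //.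
  + by move=> k; rewrite !lowE !dE'; lra.
  + by move=> k; rewrite !highE !dE'; have := sorted0 k; lra.
  + by rewrite lowE highE; have := d0 o0; lra.
  + by rewrite heightE.
  + have [p0_lt|p10] := ltP (p (s o0)) (p (s o1)).
      (* A unique lowest diagonal gives, through [tie_p], the reverse of [v2_ge]. *)
      right; rewrite heightE; move: (tie_p p0_lt) v2_ge; rewrite QeE pE.
      case: (v 2%:R%R) => [r| |] //=; rewrite -?EFinD ?lee_fin => h1 h2.
      by congr _%:E; lra.
    by left; rewrite !highE !dE'; lra.
- exists (s, e, false).
  have d00 : d o0 = 0%R by case: (dE o0) (d0 o0) => ->; lra.
  have d_le k : (p (s o0) <= p (s k) - d k)%R.
    by have := sorted0 k; case: (dE k) => ->; lra.
  (* A unique lowest diagonal would bound [Q e] by [P (s o0) + P (s o0)]. But no diagonal is lowered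
     below [p (s o0)] and the second stays strictly above it, so [Q e] is larger. *)
  have p1 : p (s o1) = p (s o0).
    apply/eqP; rewrite eq_le p01 andbT leNgt; apply/negP => p0_lt.
    have : (Q e)%:E <= (P (s o0) + P (s o0))%:E.
      by apply: le_trans (tie_p p0_lt); rewrite leeDr // adde_ge0.
    rewrite lee_fin !pE.
    have : (p (s o0) < p (s o1) - d o1)%R by case: (dE o1) => ->; lra.
    by have := d_le o2; have := d_le o3; lra.
  have d01 : d o1 = 0%R by case: (dE o1) (d0 o1) => ->; lra.
  have := sorted0 o2; have := dt o2; have := dt o3; have := d0 o2; have := d0 o3.
  move=> d3_ge0 d2_ge0 d3_ge d2_ge p02.
  (* If the third diagonal is untouched, its two vertices agree; otherwise the third and fourth are
     both lowered to the water level. *)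
  by apply: path_cell_valid => //; rewrite ?lowE ?highE ?d00 ?d01 ?p1;
    case: (dE o2) d2_ge0 d2_ge => ->; case: (dE o3) d3_ge0 d3_ge => ->;
    move=> *; first [lra | left; lra | right; lra].
Qed.

End Existence.

Theorem theorem7p3 (R : realType) (K : fieldType) (v : K -> \bar R)
    (v_val : ring_valuation v)
    (v_surj : forall y : \bar R, y != -oo -> exists c, v c = y) :
  exists sigma : {ptws cube -> R} -> {ptws coord_ring K -> \bar R},
    [/\ {within TropX0 v, continuous sigma},
        forall xi, TropX0 v xi -> Zan0 v (sigma xi),
        forall xi, TropX0 v xi -> trop (sigma xi) = EFin \o xi
      & forall tau xi, TropX0 v xi ->
          sigma (trop_act tau xi) = mu tau (sigma xi)].
Proof.
by apply: section_of_valid_cells => // xi; exact: valid_cell_exists.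
Qed.
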